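(* Let $t_0\in\mathbb{R}$, let $\ell_0,\ell_1,f\in V$, let $\sigma\in\Sigma$ and $\ell_0\in V_{t_0}(\sigma)$. Suppose $f(0)(t)=0$ for a.e. $t\le t_0$, and that there exists $\kappa>0$ such that: (i) $f(v)(t)\ge 0$ for a.e. $t\le t_0$ and every $v\in C_0(\mathbb{R};[0,\kappa])$; (ii) $f(v)(t)\,\operatorname{sgn} v(t)\le q(t,\|v\|)$ for a.e. $t\ge t_0$ and every $v\in C_0(\mathbb{R};\mathbb{R})$ with $0\le v(t_0)\le\kappa$ and $-\kappa\le v(t)\le\kappa$ for $t\le t_0$, where $q\in K_{loc}([t_0,+\infty)\times\mathbb{R}_+;\mathbb{R}_+)$ is nondecreasing in the second argument and satisfies $\lim_{x\to+\infty}\frac1x\int_{t_0}^b q(s,x)\,ds=0$ for every $b>t_0$. Let, moreover, there exist $\gamma\in AC_{loc}((-\infty,t_0];(0,+\infty))$ such that $$\gamma'(t)\le-\ell_1(\gamma)(t)\quad\text{and}\quad \ell_0(1)(t)\ge\frac{\ell_1(\gamma)(t)}{\gamma(t)}\qquad\text{for a.e. }t\le t_0,$$ and $$M_\sigma:=\sup\left\{\int_{\sigma(t)}^t\frac{\ell_1(\gamma)(s)}{\gamma(s)}\,ds:\ t\le t_0\right\}<+\infty.$$ Then, for every $c\in[0,\kappa e^{-M_\sigma}]$, there exists a global solution $u$ to $u'(t)=\ell_0(u)(t)-\ell_1(u)(t)+f(u)(t)$, $u(t_0)=c$, satisfying $0\le u(t)\le\kappa$ for $t\le t_0$.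
   Context: Notation. $\mathbb{R}_+=[0,+\infty)$. $C_{loc}(\mathbb{R};\mathbb{R})$ is the space of continuous functions $\mathbb{R}\to\mathbb{R}$ with the topology of uniform convergence on every compact interval. $L_{loc}(\mathbb{R};\mathbb{R})$ is the space of locally Lebesgue-integrable functions on $\mathbb{R}$ with the topology of convergence in the mean on every compact interval. For $I,D\subseteq\mathbb{R}$: $C_0(I;D)$ is the set of bounded continuous functions $I\to D$; $AC_{loc}(I;D)$ is the set of functions $I\to D$ absolutely continuous on every compact interval contained in $I$; $L_{loc}(I;\mathbb{R}_+)$ is the set of functions $I\to\mathbb{R}_+$ integrable on every compact interval contained in $I$. $\|v\|=\sup\{|v(t)|:t\in\mathbb{R}\}$. $\operatorname{sgn}$ is the sign function with $\operatorname{sgn}0=0$. $K_{loc}([t_0,+\infty)\times\mathbb{R}_+;\mathbb{R}_+)$ is the set of functions $q:[t_0,+\infty)\times\mathbb{R}_+\to\mathbb{R}_+$ such that $q(\cdot,x)$ is measurable for every $x$, $q(t,\cdot)$ is continuous for a.e. $t$, and for every compact $D\subset\mathbb{R}_+$ the function $\sup\{q(\cdot,x):x\in D\}$ is integrable on every compact subinterval of $[t_0,+\infty)$. Standing assumptions. $\ell_0,\ell_1:C_{loc}(\mathbb{R};\mathbb{R})\to L_{loc}(\mathbb{R};\mathbb{R})$ are linear continuous operators which are positive (map non-negative functions to non-negative functions). $f:C_{loc}(\mathbb{R};\mathbb{R})\to L_{loc}(\mathbb{R};\mathbb{R})$ is a continuous operator satisfying the local Carathéodory conditions: for every $r>0$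 there is $q_r\in L_{loc}(\mathbb{R};\mathbb{R}_+)$ with $|f(v)(t)|\le q_r(t)$ for a.e. $t\in\mathbb{R}$ whenever $\sup_{\mathbb{R}}|v|\le r$. If $I\subseteq\mathbb{R}$ is a closed interval, $u:I\to\mathbb{R}$ is continuous and $T:C_{loc}(\mathbb{R};\mathbb{R})\to L_{loc}(\mathbb{R};\mathbb{R})$ is a continuous operator, then $T(u):=T(\vartheta(u))$, where $\vartheta(u)$ is the extension of $u$ to $\mathbb{R}$ equal to $u(\inf I)$ to the left of $I$ (if $\inf I>-\infty$) and $u(\sup I)$ to the right of $I$ (if $\sup I<+\infty$). $T(1)$ and $T(0)$ are the values of $T$ at constant functions. For $\tau\in\mathbb{R}$, $V_\tau$ is the set of continuous operators $T:C_{loc}(\mathbb{R};\mathbb{R})\to L_{loc}(\mathbb{R};\mathbb{R})$ such that for every $\zeta\le\tau$, $T(u)(t)=T(v)(t)$ for a.e. $t\le\zeta$ whenever $u,v\in C_{loc}(\mathbb{R};\mathbb{R})$ and $u=v$ on $(-\infty,\zeta]$. $V=\bigcap_{\tau\in\mathbb{R}}V_\tau$. $\Sigma$ is the set of continuous $\sigma:\mathbb{R}\to\mathbb{R}$ with $\sigma(t)\le t$ for all $t$. For $\sigma\in\Sigma$, $V_\tau(\sigma)$ is the set of continuous operators $T:C_{loc}(\mathbb{R};\mathbb{R})\to L_{loc}(\mathbb{R};\mathbb{R})$ such that, for a.e. $t\le\tau$, $T(u)(t)=T(v)(t)$ whenever $u,v\in C_{loc}(\mathbb{R};\mathbb{R})$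 satisfy $u(s)=v(s)$ for $s\in[\sigma(t),t]$. A global solution is a function $u:\mathbb{R}\to\mathbb{R}$ absolutely continuous on every compact interval and satisfying the equation for a.e. $t\in\mathbb{R}$. *)

(* Defs.v *)
From mathcomp Require Import all_boot all_order all_algebra.
From mathcomp Require Import all_classical all_reals all_analysis.
Set Implicit Arguments.
Unset Strict Implicit.
Unset Printing Implicit Defensive.
Import Order.TTheory GRing.Theory Num.Theory.
Import numFieldNormedType.Exports.
Local Open Scope classical_set_scope.
Local Open Scope ring_scope.

Section Defs.
Context {R : realType}.
Implicit Types (I D : set R) (u v : R -> R) (t tau : R).

Notation mu := (@lebesgue_measure R).

(* [lebesgue_measure] lives on the Borel sigma-algebra. Measurability and
   integrability in the sense of Lebesgue, i.e., with respect to the completed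
   measure, amount to being a.e. equal to a Borel function with that property;
   the value of the integral does not depend on the choice of this function. *)
Definition lebesgue_measurable I (g : R -> R) : Prop :=
  exists2 h : R -> R, measurable_fun I h & ae_eq mu I g h.

Definition lebesgue_integrable I (g : R -> R) : Prop :=
  exists2 h : R -> R, mu.-integrable I (EFin \o h) & ae_eq mu I g h.

(* The library's [locally_integrable] is restricted to open domains. *)
Definition Lloc I (g : R -> R) : Prop :=
  forall a b : R, a <= b -> `[a, b] `<=` I -> lebesgue_integrable `[a, b] g.

Definition Cloc : set {family compact, R -> R} :=
  [set u | continuous (u : R -> R)].

Definition C0 D u : Prop :=
  [/\ continuous u, bounded_fun u & forall t, D (u t)].

Definition sup_norm u : R := sup [set `|u t| | t in [set: R]].

Definition abs_continuous (a b : R) u : Prop :=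
  forall e : R, 0 < e -> exists2 d : R, 0 < d &
    forall (n : nat) (x y : 'I_n -> R),
      (forall k, [/\ a <= x k, x k <= y k & y k <= b]) ->
      trivIset [set: 'I_n] (fun k => `]x k, y k[%classic) ->
      \sum_k (y k - x k) < d -> \sum_k `|u (y k) - u (x k)| < e.

Definition ACloc I D u : Prop :=
  (forall t, I t -> D (u t)) /\
  (forall a b : R, a <= b -> `[a, b] `<=` I -> abs_continuous a b u).

(* A map from C_loc(R; R) to L_loc(R; R) is represented by a map [T] sending a
   function to a representative of a class modulo a.e. equality; only the values
   of [T] at continuous functions matter. *)
Definition operator := (R -> R) -> (R -> R).
Implicit Types T : operator.

Definition continuous_operator T : Prop :=
  (forall u, continuous u -> Lloc setT (T u)) /\
  (forall u, continuous u -> forall a b : R, a <= b ->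
    (fun v : {family compact, R -> R} =>
       (\int[mu]_(t in `[a, b]) `|T v t - T u t|%:E)%E)
      @ within Cloc (nbhs (u : {family compact, R -> R})) --> 0%E).

Definition linear_operator T : Prop :=
  forall (a : R) u v, continuous u -> continuous v ->
    {ae mu, forall t, T (fun s => a * u s + v s) t = a * T u t + T v t}.

Definition positive_operator T : Prop :=
  forall u, continuous u -> (forall t, 0 <= u t) -> {ae mu, forall t, 0 <= T u t}.

Definition local_caratheodory T : Prop :=
  forall r : R, 0 < r -> exists qr : R -> R,
    [/\ Lloc setT qr, forall t, 0 <= qr t &
        forall v, continuous v -> (forall t, `|v t| <= r) ->
          {ae mu, forall t, `|T v t| <= qr t}].

Definition V_at tau T : Prop :=
  continuous_operator T /\
  forall zeta : R, zeta <= tau ->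
  forall u v, continuous u -> continuous v ->
    (forall t, t <= zeta -> u t = v t) ->
    {ae mu, forall t, t <= zeta -> T u t = T v t}.

Definition V T : Prop := forall tau, V_at tau T.

Definition Sigma (sigma : R -> R) : Prop :=
  continuous sigma /\ forall t, sigma t <= t.

(* As [T u] and [T v] are only determined up to null sets, the exceptional null
   set may depend on [u] and [v]. *)
Definition V_sigma tau (sigma : R -> R) T : Prop :=
  continuous_operator T /\
  forall u v, continuous u -> continuous v ->
    {ae mu, forall t, t <= tau ->
       (forall s, sigma t <= s <= t -> u s = v s) -> T u t = T v t}.

Definition Kloc (t0 : R) (q : R -> R -> R) : Prop :=
  [/\ forall t x, t0 <= t -> 0 <= x -> 0 <= q t x,
      forall x, 0 <= x -> lebesgue_measurable `[t0, +oo[ (q^~ x),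
      {ae mu, forall t, t0 <= t -> {within `[0, +oo[, continuous (q t)}} &
      forall D, compact D -> D `<=` `[0, +oo[ ->
        Lloc `[t0, +oo[ (fun t => sup [set q t x | x in D])].

(* The value of an operator at a function given on ]-oo, t0] is by convention its
   value at this extension. *)
Definition extend_right (t0 : R) u : R -> R := fun t => u (Num.min t t0).

Definition M_sigma (l1 : operator) (gamma sigma : R -> R) (t0 : R) : \bar R :=
  ereal_sup [set (\int[mu]_(s in `[sigma t, t])
                    (l1 (extend_right t0 gamma) s / gamma s)%:E)%E
            | t in `]-oo, t0]].

Definition global_solution (l0 l1 f : operator) u : Prop :=
  ACloc setT setT u /\
  {ae mu, forall t, is_derive t 1 u (l0 u t - l1 u t + f u t)}.

End Defs.

(* Main.v *)
(* Replacing the operators by Borel representatives turns the equation into the integral equation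
   u(t) - u(s) = int_s^t (l0 u - l1 u + f u).

   On [a, t0], with constant history on the left of a, existence for the truncated equation comes
   from Tonelli's delayed approximations. The function v / gamma is nondecreasing: gamma decays at
   least as fast as l1 makes it. So l1 v <= (l1 gamma / gamma) v, and v decays at most at the rate
   l1 gamma / gamma <= l0 1. By the delay condition on l0, after the last time at which sigma looks
   back beyond t1 the value cannot fall below the minimum reached so far, hence
   v(t1) e^{-M} <= v(t) for t1 <= t. Consequently u <= kappa whenever u(t0) <= kappa e^{-M}, and the
   initial value at a is found by shooting between the zero solution and the one starting at
   2 kappa; as uniqueness may fail, the shooting is done along the approximations.

   To the right of t0 a Gronwall estimate, together with the sublinear growth of q, bounds all
   solutions a priori, so they extend to [t0, T]. Letting a -> -oo and T -> +oo along an
   ultrafilter, equicontinuity gives a global solution as a limit. *)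
From HB Require Import structures.
Require Import Defs.
From mathcomp Require Import all_boot all_order all_algebra.
From mathcomp Require Import all_classical all_reals all_analysis.
From mathcomp Require Import measurable_realfun ring lra.
Set Implicit Arguments.
Unset Strict Implicit.
Unset Printing Implicit Defensive.
Import Order.TTheory GRing.Theory Num.Theory.
Import numFieldNormedType.Exports.
Local Open Scope classical_set_scope.
Local Open Scope ring_scope.

(** Operator values are fixed only up to null sets that depend on the argument, so their value at a
    single chosen time carries no information. Solutions are therefore continuous functions
    satisfying an integral equation, inequalities between operator values are integrated before use,
    and derivatives of solutions reappear only at the very end. The hypothesis on [gamma] bounds its
    derivative almost everywhere. Passing to the integrated bound requires that an absolutely
    continuous function is the integral of its derivative; the variation and Stieltjes measure
    arguments serve this purpose. Gronwall's inequality is stated with increments and suprema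
    instead of derivatives, because it is also applied to running suprema. Its exponent must be
    exact, since it becomes the factor [expR (- M)]. An ultrafilter makes bounded sequences converge
    without subsequences, and it decides between two alternatives for the indices, which is how the
    shooting ends. *)

Section Integral.
Context {R : realType}.
Implicit Types (a b s t : R) (g h u v : R -> R).
Notation mu := (@lebesgue_measure R).

Lemma aeS (P Q : R -> Prop) : (forall t, P t -> Q t) ->
  {ae mu, forall t, P t} -> {ae mu, forall t, Q t}.
Proof. by move=> PQ; apply: filterS; first exact: (ae_filter_ringOfSetsType mu). Qed.

Lemma aeS2 (P Q S : R -> Prop) : (forall t, P t -> Q t -> S t) ->
  {ae mu, forall t, P t} -> {ae mu, forall t, Q t} -> {ae mu, forall t, S t}.
Proof. by move=> PQ; apply: filterS2; first exact: (ae_filter_ringOfSetsType mu). Qed.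

Lemma aeS3 (P Q S T : R -> Prop) : (forall t, P t -> Q t -> S t -> T t) ->
  {ae mu, forall t, P t} -> {ae mu, forall t, Q t} -> {ae mu, forall t, S t} ->
  {ae mu, forall t, T t}.
Proof. by move=> PQ; apply: filterS3; first exact: (ae_filter_ringOfSetsType mu). Qed.

Lemma aeT (P : R -> Prop) : (forall t, P t) -> {ae mu, forall t, P t}.
Proof. by move=> H; apply: aeW. Qed.

Lemma ae_nat (P : nat -> R -> Prop) : (forall n, {ae mu, forall t, P n t}) ->
  {ae mu, forall t n, P n t}.
Proof. exact: ae_foralln. Qed.

(** * Locally integrable Borel functions and their integrals over intervals *)

Definition locint h := measurable_fun setT h /\
  forall a b, mu.-integrable `[a, b] (EFin \o h).

(** Not an oriented integral: for [b < a] the interval is empty and the value is 0. Hence additivity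
    is stated for ordered endpoints only. *)
Definition I h a b := \int[mu]_(x in `[a, b]) h x.

Lemma locint_cst (k : R) : locint (fun=> k).
Proof.
split=> [|a b]; first exact: measurable_cst.
apply: continuous_compact_integrable; first exact: segment_compact.
by apply: continuous_subspaceT => x; exact: cvg_cst.
Qed.

Lemma locintD g h : locint g -> locint h -> locint (fun t => g t + h t).
Proof.
move=> [mg ig] [mh ih]; split=> [|a b]; first exact: measurable_funD.
by apply: eq_integrable (integrableD _ (ig a b) (ih a b)).
Qed.

Lemma locintZ (k : R) g : locint g -> locint (fun t => k * g t).
Proof.
move=> [mg ig]; split=> [|a b]; first exact: measurable_funM.
by apply: eq_integrable (integrableZl _ k (ig a b)).
Qed.

Lemma locintB g h : locint g -> locint h -> locint (fun t => g t - h t).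
Proof.
move=> [mg ig] [mh ih]; split=> [|a b]; first exact: measurable_funB.
by apply: eq_integrable (integrableB _ (ig a b) (ih a b)).
Qed.

Lemma locint_abs g : locint g -> locint (fun t => `|g t|).
Proof.
move=> [mg ig]; split=> [|a b]; first exact: measurableT_comp.
exact: (integrable_norm (ig a b)).
Qed.

Lemma I_chasles h a b c : locint h -> a <= b -> b <= c ->
  I h a c = I h a b + I h b c.
Proof.
move=> [_ ih] ab bc; rewrite /I.
have := @Rintegral_itvB _ h (BLeft a) (BRight c) b (ih a c) _ _.
rewrite !bnd_simp => /(_ ab bc) e.
rewrite -(Rintegral_itv_obnd_cbnd (r := b)); first by lra.
by apply: integrableS (ih b c) => //; apply: subset_itvr; rewrite bnd_simp.
Qed.

Lemma ID g h a b : locint g -> locint h -> I (fun t => g t + h t) a b = I g a b + I h a b.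
Proof. by move=> [_ ig] [_ ih]; exact: RintegralD. Qed.

Lemma IB g h a b : locint g -> locint h -> I (fun t => g t - h t) a b = I g a b - I h a b.
Proof. by move=> [_ ig] [_ ih]; exact: RintegralB. Qed.

Lemma IZ (k : R) g a b : locint g -> I (fun t => k * g t) a b = k * I g a b.
Proof. by move=> [_ ig]; exact: RintegralZl. Qed.

Lemma I_refl h a : I h a a = 0.
Proof. by rewrite /I set_itv1 Rintegral_set1. Qed.

Lemma I_abs h a b : locint h -> `|I h a b| <= I (fun t => `|h t|) a b.
Proof. by move=> [_ ih]; exact: le_normr_Rintegral. Qed.

Lemma eq_I_ae g h a b : locint g -> locint h ->
  {ae mu, forall t, a <= t <= b -> g t = h t} -> I g a b = I h a b.
Proof.
move=> [mg ig] [mh ih] gh; rewrite /I /Rintegral; congr fine.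
apply: ae_eq_integral => //.
- exact/measurable_funTS/measurableT_comp.
- exact/measurable_funTS/measurableT_comp.
- by apply: (aeS _ gh) => t; rewrite /= in_itv /= => + /[dup] H => /(_ H) ->.
Qed.

(** Almost everywhere on the interval [h] coincides with the maximum of [g] and [h], which dominates
    [g] at every point, so the pointwise comparison of integrals applies. *)
Lemma le_I g h a b : locint g -> locint h ->
  {ae mu, forall t, a <= t <= b -> g t <= h t} -> I g a b <= I h a b.
Proof.
move=> lg lh gh.
have lm : locint (fun t => Num.max (g t) (h t)).
  have -> : (fun t => Num.max (g t) (h t)) = (fun t => 2^-1 * ((g t + h t) + `|g t - h t|)).
    by apply/funext => t; rewrite maxr_absE mulrC.
  by apply/locintZ/locintD; [exact: locintD|apply/locint_abs/locintB].
rewrite (@eq_I_ae h (fun t => Num.max (g t) (h t)))//.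
  apply: le_Rintegral => //; [exact: lg.2|exact: lm.2|].
  by move=> x _; rewrite le_max lexx.
apply: (aeS _ gh) => t + tab => /(_ tab) ?.
by apply/esym/max_idPr.
Qed.

Lemma ae_neq (c : R) : {ae mu, forall t : R, t != c}.
Proof.
exists [set c]; split => //; first exact: lebesgue_measure_set1.
by move=> t /= /negP; rewrite negbK => /eqP.
Qed.

Lemma le_I_oo g h a b : locint g -> locint h ->
  {ae mu, forall t, a < t < b -> g t <= h t} -> I g a b <= I h a b.
Proof.
move=> lg lh gh; apply: le_I => //.
apply: aeS3 gh (ae_neq a) (ae_neq b) => t H ta tb /andP[a1 b1].
by apply: H; rewrite !lt_neqAle eq_sym ta a1 tb b1.
Qed.

Lemma I_ge0 h a b : locint h -> {ae mu, forall t, a <= t <= b -> 0 <= h t} -> 0 <= I h a b.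
Proof.
move=> lh h0; have := le_I (locint_cst 0) lh h0; apply: le_trans.
by rewrite /I Rintegral_cst// mul0r.
Qed.

Lemma le_I_itv h a b s t : locint h -> {ae mu, forall t, 0 <= h t} ->
  a <= s -> s <= t -> t <= b -> I h s t <= I h a b.
Proof.
move=> lh h0 as_ st tb.
rewrite (I_chasles lh as_ (le_trans st tb)) (I_chasles lh st tb).
have H c d : 0 <= I h c d by apply: I_ge0 => //; apply: (aeS _ h0).
have := H a s; have := H t b; lra.
Qed.

Lemma I_small h a b (e : R) : locint h -> 0 < e -> exists2 d : R, 0 < d &
  forall A, measurable A -> A `<=` `[a, b] -> (mu A < d%:E)%E -> \int[mu]_(x in A) `|h x| < e.
Proof.
move=> [mh ih] e0.
have ihr : mu.-integrable setT (EFin \o (h \_ `[a, b])).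
  by have := ih a b; rewrite integrable_mkcond// restrict_EFin.
have [d [d0 H]] := integral_normr_continuous ihr e0.
exists d => // A mA Aab /(H _ mA); congr (_ < _).
by apply: eq_Rintegral => x /set_mem/Aab/mem_set xab; rewrite patchE xab.
Qed.

Lemma I_unif h a b (e : R) : locint h -> 0 < e -> exists2 d : R, 0 < d &
  forall s t, a <= s -> s <= t -> t <= b -> t - s < d -> I (fun x => `|h x|) s t < e.
Proof.
move=> lh e0; have [d d0 H] := I_small a b lh e0; exists d => // s t as_ st tb tsd.
apply: H => //; first by apply: subset_itvScc; rewrite bnd_simp.
by rewrite lebesgue_measure_itv /= lte_fin; case: (ltP s t) => _; rewrite lte_fin.
Qed.

(** The disjoint intervals are merged into their union [D], whose measure is their total length, so
    that the absolute continuity of the integral is applied to one set. *)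
Lemma I_ac g u a b : locint g ->
  (forall s t, a <= s -> s <= t -> t <= b -> `|u t - u s| <= I g s t) ->
  abs_continuous a b u.
Proof.
move=> lg H e e0; have [d d0 Hd] := I_small a b lg e0; exists d => // n x y xy triv xyd.
pose F (k : 'I_n) : set R := `]x k, y k[%classic.
pose D := \big[setU/set0]_(k <- index_enum 'I_n) F k.
have mF k : measurable (F k) by exact: measurable_itv.
have un : uniq (index_enum 'I_n) by exact: index_enum_uniq.
have tr : trivIset [set` index_enum 'I_n] F by exact: sub_trivIset triv.
have mD : measurable D by apply: bigsetU_measurable.
have Dab : D `<=` `[a, b].
  rewrite /D; elim/big_ind : _ => //= [A B HA HB z [/HA|/HB]//|k _ z].
  rewrite /F /= !in_itv /=; have [] := xy k; lra.
have muD : mu D = (\sum_k (y k - x k))%:E.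
  have := @ge0_integral_bigsetU _ _ _ mu _ F (cst 1%E) _ mF un tr.
  rewrite -/D /= => /(_ (measurable_cst _) (fun _ _ => lee01)).
  rewrite (integral_cst mu mD 1%E) mul1e => ->.
  rewrite -sumEFin; apply: eq_bigr => k _; rewrite (integral_cst mu (mF k) 1%E) mul1e.
  transitivity (mu `]x k, y k[%classic); first by [].
  rewrite lebesgue_measure_itv /= lte_fin; have [_ xyk _] := xy k.
  case: ltP => [_|h]; first by rewrite EFinB.
  by have -> : y k = x k by [lra]; rewrite subrr.
have /Hd := mD; rewrite muD lte_fin => /(_ Dab xyd).
apply: le_lt_trans; rewrite /Rintegral.
rewrite (@ge0_integral_bigsetU _ _ _ mu _ F (fun x => `|g x|%:E) _ mF un tr) //; last first.
- by apply: measurable_funTS; apply/measurable_EFinP; exact: (locint_abs lg).1.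
have ig (i j : bool) k : mu.-integrable [set` Interval (BSide i (x k)) (BSide j (y k))]
    (EFin \o (fun z => `|g z|)).
  apply: (integrableS _ _ _ ((locint_abs lg).2 (x k) (y k))) => //.
  by apply: subset_itvScc; rewrite bnd_simp.
have fin k : (\int[mu]_(z in F k) `|g z|%:E \is a fin_num)%E.
  by apply: (integrable_fin_num _ (ig false true k)).
rewrite -sum_fine //; apply: ler_sum => k _.
have [h1 h2 h3] := xy k.
apply: (le_trans (H _ _ h1 h2 h3)).
apply: (le_trans (ler_norm _)); apply: (le_trans (I_abs _ _ lg)).
by rewrite /I -(Rintegral_itv_obnd_cbnd (ig _ _ k)) -(Rintegral_itv_bndo_bndc (ig _ _ k)).
Qed.

Lemma locint_locally h : locint h -> locally_integrable setT h.
Proof.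
move=> lh; split; [exact: lh.1|exact: openT|move=> K _ cK].
have [M [_ HM]] := compact_bounded cK.
have sub : K `<=` `[- (`|M| + 1), `|M| + 1].
  move=> x Kx; rewrite /= in_itv /= -ler_norml; apply: HM => //.
  by have := ler_norm M; lra.
have /integrableP[_ +] := integrable_norm (lh.2 (- (`|M| + 1)) (`|M| + 1)).
apply: le_lt_trans; under [leRHS]eq_integral do rewrite /= normr_id.
apply: ge0_subset_integral => //.
- exact: compact_measurable.
- by apply: measurable_funTS; apply/measurable_EFinP; exact: (locint_abs lh).1.
Qed.

(** Lebesgue's differentiation theorem for the primitive based at [a]; near an interior point [u]
    differs from that primitive by the constant [u a]. *)
Lemma ae_is_derive_I_itv h u a b : locint h ->
  (forall s t, a <= s -> s <= t -> t <= b -> u t - u s = I h s t) ->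
  {ae mu, forall t, a < t < b -> is_derive t 1 u (h t)}.
Proof.
move=> lh uh; have lo := locint_locally lh.
have ih y : mu.-integrable [set` Interval (BLeft a) (BRight y)] (EFin \o h).
  exact: lh.2.
have := FTC1 ih lo; apply: aeS => t H /andP[ta tb].
have [|dF eF] := H; first by first [rewrite lte_fin | exact: ltW ta | rewrite ltBSide /= ltW].
pose G y := u a + I h a y.
apply: (@near_eq_is_derive _ _ _ G).
  near=> y.
  have ay : a <= y by apply/ltW; near: y; exact: lt_nbhsr.
  have yb : y <= b by apply/ltW; near: y; exact: lt_nbhsl.
  by rewrite /G -uh //; lra.
have -> : h t = 0 + h t by rewrite add0r.
apply: is_deriveD; rewrite -eF derive1E.
exact: derivableP.
Unshelve. all: by end_near. Qed.

Lemma ae_is_derive_I h u : locint h ->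
  (forall s t, s <= t -> u t - u s = I h s t) ->
  {ae mu, forall t, is_derive t 1 u (h t)}.
Proof.
move=> lh uh.
suff /ae_nat : forall n : nat, {ae mu, forall t, - n%:R < t < n%:R -> is_derive t 1 u (h t)}.
  apply: aeS => t H; pose n := (Num.trunc `|t|).+1.
  by apply: (H n); rewrite -ltr_norml truncnS_gt.
by move=> n; apply: ae_is_derive_I_itv => // *; exact: uh.
Qed.

End Integral.

(** * Absolutely continuous functions *)

Section VariationAC.
Context {R : realType}.
Implicit Types (a b c x y : R) (f : R -> R) (p q : R * R).

(** A pair holds the right endpoint first and the left one second, as [zip s (a :: s)] lists the
    cells of a partition. *)
Definition apart p q := (p.1 <= q.2) || (q.1 <= p.2).

Lemma overlap (a b c d : R) : a < b -> c < d -> a < d -> c < b ->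
  exists z, [/\ a < z, z < b, c < z & z < d].
Proof.
move=> *; exists ((Num.max a c + Num.min b d) / 2).
by case: (ltP a c) => ?; case: (ltP b d) => ?; split; lra.
Qed.

Lemma ac_seq a b f : abs_continuous a b f -> forall e : R, 0 < e -> exists2 d : R, 0 < d &
  forall l : seq (R * R), all (fun p => (a <= p.2) && (p.2 <= p.1) && (p.1 <= b)) l ->
    pairwise apart l -> \sum_(p <- l) (p.1 - p.2) < d ->
    \sum_(p <- l) `|f p.1 - f p.2| < e.
Proof.
move=> acf e /acf[d d0 H]; exists d => // l lab dl ld.
have := H (size l) (fun k => (nth (0, 0) l k).2) (fun k => (nth (0, 0) l k).1).
rewrite !(big_nth (0, 0)) !big_mkord in ld *.
apply => //.
  move=> k; have /= := all_nthP (0, 0) lab k (ltn_ord k).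
  by move=> /andP[/andP[-> ->] ->].
apply/trivIsetP => i j _ _.
wlog ij : i j / (i < j)%N => [hw|].
  move=> ij; case: (ltngtP i j) => h; [exact: hw| |by move/val_inj: h ij => ->; rewrite eqxx].
  by rewrite setIC; apply: hw => //; rewrite eq_sym.
move=> _; have /= := pairwiseP (0, 0) dl i j (ltn_ord i) (ltn_ord j) ij.
rewrite /apart => D; rewrite -subset0 => z /= []; rewrite !in_itv /=.
by case/orP: D; lra.
Qed.

Lemma pairwise_apart_zip a s : path <=%R a s ->
  pairwise apart (zip s (a :: s)) &&
  all (fun p => (a <= p.2) && (p.2 <= p.1) && (p.1 <= last a s)) (zip s (a :: s)).
Proof.
elim: s a => [|x s IH] a //= /andP[ax /IH{IH}/andP[-> al]]; rewrite !andbT /=.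
have xl : x <= last x s.
  case: s al => [|z s] //= /andP[/andP[/andP[_ h1] h2] _]; exact: le_trans h1 h2.
rewrite lexx ax xl /=; apply/andP; split; apply/allP => p /(allP al) /andP[/andP[h1 h2] h3].
  by rewrite /apart /= h1.
by rewrite h2 h3 (le_trans ax h1).
Qed.

Lemma itv_partition_pairs a b s : itv_partition a b s ->
  [/\ pairwise apart (zip s (a :: s)),
   all (fun p => (a <= p.2) && (p.2 <= p.1) && (p.1 <= b)) (zip s (a :: s)) &
   \sum_(p <- zip s (a :: s)) (p.1 - p.2) = b - a].
Proof.
move=> abs; case: (abs) => pa /eqP lb.
have /pairwise_apart_zip/andP[h1] : path <=%R a s by apply: sub_path pa => ? ? /ltW.
rewrite lb => h2; split => //.
(* The total length of the cells is the variation of the identity. *)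
have := @nondecreasing_variation _ a b idfun s _ abs; rewrite /= => <- //.
rewrite (variation_zip _ abs); apply: eq_big_seq => p /(allP h2) /andP[/andP[_ h] _].
by rewrite /= ger0_norm // subr_ge0.
Qed.

(** The variation is at most 1 on every subinterval shorter than the [d] attached to the tolerance
    1; finitely many steps of [d / 2], stopped at [b], cover the interval. *)
Lemma ac_bounded_variation a b f : abs_continuous a b f -> a <= b ->
  bounded_variation a b f.
Proof.
move=> acf ab; have [d d0 H] := ac_seq acf ltr01.
have short c c' : a <= c -> c <= c' -> c' <= b -> c' - c < d -> bounded_variation c c' f.
  move=> ac cc cb ccd; exists 1 => _ [s cs <-]; rewrite (variation_zip _ cs).
  have [h1 h2 h3] := itv_partition_pairs cs.
  apply/ltW/H => //; last by rewrite h3.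
  apply: sub_all h2 => p /andP[/andP[? ?] ?]; apply/andP; split; last lra.
  by apply/andP; split; lra.
pose pt n := Num.min b (a + n%:R * (d / 2)).
have apt n : a <= pt n by rewrite /pt le_min ab /= lerDl mulr_ge0 // ltW // divr_gt0.
have ptb n : pt n <= b by rewrite /pt ge_min lexx.
have ptS n : pt n <= pt n.+1.
  by rewrite /pt le_min2 // lerD2l ler_wpM2r // ?ler_nat // ltW // divr_gt0.
have bv n : bounded_variation a (pt n) f.
  elim: n => [|n IH].
    by rewrite /pt mul0r addr0 (min_idPr ab); exact: bounded_variationxx.
  apply/bounded_variationP => //.
  rewrite (total_variationD f (apt n) (ptS n)) fin_numD; apply/andP; split.
    exact/bounded_variationP.
  apply/bounded_variationP => //; apply: short => //.
  rewrite /pt -natr1 mulrDl mul1r addrA; set z := a + n%:R * _.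
  by case: (ltP b z) => ?; case: (ltP b (z + d / 2)) => ?; lra.
have [n hn] : exists n : nat, b - a < n%:R * (d / 2).
  exists (Num.trunc ((b - a) / (d / 2))).+1.
  by rewrite -ltr_pdivrMr ?divr_gt0 // truncnS_gt.
have := bv n; suff -> : pt n = b by [].
by apply/min_idPl; lra.
Qed.

(* The disjoint intervals are cut along nearly optimal partitions. *)
Lemma ac_total_variation a b f : abs_continuous a b f -> a <= b ->
  abs_continuous a b (fun x => fine (total_variation a x f)).
Proof.
move=> acf ab e e0; have bv := ac_bounded_variation acf ab.
have [d d0 H] := ac_seq acf (divr_gt0 e0 (ltr0n R 2)).
exists d => // n x y xy triv xyd.
have fin u v : a <= u -> u <= v -> v <= b -> total_variation u v f \is a fin_num.
  move=> au uv vb; apply/bounded_variationP => //.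
  apply: (bounded_variationl uv vb); apply: (bounded_variationr au _ bv); lra.
(* The [n] partitions together lose at most [e / 2]; [n.+1] avoids a division by zero. *)
pose e' := e / 2 / n.+1%:R.
have e'0 : 0 < e' by rewrite !divr_gt0.
(* A degenerate interval gets the empty list, so pairs from different lists are compared only when
   both intervals have interior points, as [overlap] demands. *)
have part k : exists l : seq (R * R),
    [/\ pairwise apart l,
     all (fun p => (x k <= p.2) && (p.2 <= p.1) && (p.1 <= y k)) l,
     \sum_(p <- l) (p.1 - p.2) <= y k - x k,
     l != [::] -> x k < y k &
     fine (total_variation (x k) (y k) f) <= \sum_(p <- l) `|f p.1 - f p.2| + e'].
  have [ax xyk yb] := xy k.
  case: (ltP (x k) (y k)) => xlt; last first.
    have -> : y k = x k by lra.
    exists [::]; split => //; first by rewrite big_nil; lra.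
    by rewrite total_variationxx big_nil add0r ltW.
  have fxy := fin _ _ ax xyk yb.
  have [z [_ [s xs <-] <-] hz] := ub_ereal_sup_adherent e'0 fxy.
  have [h1 h2 h3] := itv_partition_pairs xs.
  exists (zip s (x k :: s)); split => //; first by rewrite h3.
  rewrite -(variation_zip _ xs) -lee_fin EFinD fineK //.
  by move/ltW: hz; rewrite leeBlDr.
have [L LP] := choice part.
pose l := flatten [seq L k | k <- index_enum 'I_n].
have sumE (F : R * R -> R) : \sum_(p <- l) F p = \sum_k \sum_(p <- L k) F p.
  by rewrite /l big_flatten /= big_map.
have h1 : all (fun p => (a <= p.2) && (p.2 <= p.1) && (p.1 <= b)) l.
  apply/allP => p /flattenP[l' /mapP[k _ ->]] pl.
  have [_ /allP/(_ p pl)/andP[/andP[xp pp] py] _ _ _] := LP k.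
  by have [ax _ yb] := xy k; rewrite (le_trans ax xp) pp (le_trans py yb).
have h2 : pairwise apart l.
  rewrite /l; have := index_enum_uniq 'I_n; elim: (index_enum _) => //= k ks IH /andP[kks /IH{}IH].
  rewrite pairwise_cat IH andbT; have [-> hk _ nek _] := LP k; rewrite andbT.
  apply/allrelP => p q pk /flattenP[l' /mapP[j jks ->]] qj.
  have [_ hj _ nej _] := LP j.
  have jk : k != j by apply: contraNneq kks => ->.
  have xyk : x k < y k by apply: nek; apply: contraTneq pk => ->.
  have xyj : x j < y j by apply: nej; apply: contraTneq qj => ->.
  have /andP[/andP[? ?] ?] := allP hk p pk.
  have /andP[/andP[? ?] ?] := allP hj q qj.
  have /trivIsetP/(_ k j Logic.I Logic.I jk) := triv.
  rewrite -subset0 => dis; rewrite /apart.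
  case: (lerP p.1 q.2) => //= h; rewrite leNgt; apply/negP => h'.
  have [z zz] : exists z, [/\ x k < z, z < y k, x j < z & z < y j].
    by apply: overlap => //; lra.
  by case: zz => *; apply: (dis z); split; rewrite /= in_itv /=; apply/andP.
have h3 : \sum_(p <- l) (p.1 - p.2) < d.
  apply: le_lt_trans xyd; rewrite sumE; apply: ler_sum => k _.
  by have [] := LP k.
have {H} := H l h1 h2 h3; rewrite sumE => H.
apply: (@le_lt_trans _ _ (\sum_k (\sum_(p <- L k) `|f p.1 - f p.2| + e'))).
  apply: ler_sum => k _; have [ax xyk yb] := xy k.
  have ay : a <= y k by lra.
  have xb : x k <= b by lra.
  rewrite (total_variationD f ax xyk) fineD ?fin // addrC addKr ger0_norm; last first.
    by rewrite fine_ge0 // total_variation_ge0.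
  by have [_ _ _ _] := LP k.
rewrite big_split /= sumr_const card_ord.
have : e' *+ n <= e / 2.
  rewrite /e' -[_ *+ n]mulr_natr -mulrA ler_piMr ?divr_ge0 ?(ltW e0) //.
  by rewrite mulrC ler_pdivrMr ?ltr0n // mul1r ler_nat.
move=> he; rewrite [ltRHS]splitr; exact: ltr_leD H he.
Qed.

End VariationAC.

(** * Absolutely continuous functions as integrals, via Stieltjes measures *)

Section ACDensity.
Context {R : realType}.
Implicit Types (a b c x y : R) (f F : R -> R).
Notation mu := (@lebesgue_measure R).

Definition clip a b x := Num.max a (Num.min b x).

Lemma clip_itv a b x : a <= b -> a <= clip a b x <= b.
Proof. by move=> ab; rewrite /clip le_max lexx ge_max ab ge_min lexx. Qed.

Lemma clip_id a b x : a <= x <= b -> clip a b x = x.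
Proof.
move=> /andP[ax xb]; rewrite /clip; case: (leP b x) => bx.
  by have -> : b = x by [lra]; rewrite (max_idPr ax).
by rewrite (max_idPr ax).
Qed.

Lemma clip_le a b x y : x <= y -> clip a b x <= clip a b y.
Proof. by move=> xy; rewrite /clip; apply: le_max2 => //; exact: le_min2. Qed.

Lemma clip_lip a b x y : `|clip a b x - clip a b y| <= `|x - y|.
Proof.
wlog xy : x y / x <= y => [hw|].
  by case: (leP x y) => [|/ltW] /hw //; rewrite distrC (distrC x).
rewrite distrC (distrC x) !ger0_norm ?subr_ge0 ?clip_le // /clip.
by case: (leP b x) => ?; case: (leP b y) => ?; case: (leP a b) => ?;
  case: (leP a x) => ?; case: (leP a y) => ?; lra.
Qed.

(** Clipping is monotone and nonexpansive; in this form one-sided estimates pass from solutions to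
    their truncations. *)
Lemma clip_shift lo hi x y (c : R) : 0 <= c -> x <= y + c -> clip lo hi x <= clip lo hi y + c.
Proof.
move=> c0 xy; apply: (le_trans (clip_le lo hi xy)).
have := clip_lip lo hi (y + c) y; have := ler_norm (clip lo hi (y + c) - clip lo hi y).
have -> : y + c - y = c by ring.
by rewrite (ger0_norm c0); lra.
Qed.

Lemma clip_inside r x : `|clip (- r) r x| < r -> clip (- r) r x = x.
Proof.
rewrite /clip ltr_norml; case: (leP r x) => rx; last case: (leP (- r) x) => // xr.
  by case: (leP (- r) r) => _ /andP[]; rewrite ltxx.
by move=> /andP[]; rewrite ltxx.
Qed.

Lemma ac_unif a b f : abs_continuous a b f -> forall e : R, 0 < e -> exists2 d : R, 0 < d &
  forall x y, a <= x <= b -> a <= y <= b -> `|x - y| < d -> `|f x - f y| < e.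
Proof.
move=> acf e /acf[d d0 H]; exists d => // x y.
wlog xy : x y / x <= y => [hw|].
  by case: (leP x y) => [|/ltW] /hw // {}hw *; rewrite distrC hw // distrC.
move=> /andP[ax xb] /andP[ay yb]; rewrite distrC ger0_norm ?subr_ge0 // => yx.
have := H 1%N (fun=> x) (fun=> y); rewrite !big_ord_recl !big_ord0 !addr0 distrC; apply => //.
by apply/trivIsetP => i j _ _; rewrite !ord1 eqxx.
Qed.

Lemma ac_clip_continuous a b f : a <= b -> abs_continuous a b f -> continuous (f \o clip a b).
Proof.
move=> ab acf x; apply/cvgrPdist_lt => e /(ac_unif acf)[d d0 H].
near=> y => /=; apply: H; rewrite ?clip_itv //.
apply: le_lt_trans (clip_lip _ _ _ _) _.
by near: y; exact: cvgr_dist_lt.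
Unshelve. all: by end_near. Qed.

Lemma acB a b f g : abs_continuous a b f -> abs_continuous a b g ->
  abs_continuous a b (fun x => f x - g x).
Proof.
move=> acf acg e e0; have [d d0 Hf] := acf _ (divr_gt0 e0 (ltr0n R 2)).
have [d' d'0 Hg] := acg _ (divr_gt0 e0 (ltr0n R 2)).
exists (Num.min d d') => [|n x y xy tr]; first by rewrite lt_min d0 d'0.
rewrite lt_min => /andP[h1 h2].
have := Hf n x y xy tr h1; have := Hg n x y xy tr h2 => H1 H2.
rewrite [e]splitr; apply: le_lt_trans (ltrD H2 H1).
rewrite -big_split /=; apply: ler_sum => k _.
have -> : f (y k) - g (y k) - (f (x k) - g (x k)) =
  (f (y k) - f (x k)) - (g (y k) - g (x k)) by ring.
exact: ler_normB.
Qed.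

Section Nondecreasing.
Variables (a b : R) (F : R -> R).
Hypotheses (ab : a < b) (ndF : {homo F : x y / x <= y}) (acF : abs_continuous a b F)
  (clipF : forall x, F x = F (clip a b x)).

Let rcF : right_continuous F.
Proof.
apply/right_continuousW => x.
have -> : F = F \o clip a b by apply/funext => z; rewrite /= clipF.
exact: ac_clip_continuous (ltW ab) acF x.
Qed.

Let Fc : cumulative R R := HB.pack F (isCumulative.Build R _ R F ndF rcF).

Let ls : {measure set (measurableTypeR R) -> \bar R} := lebesgue_stieltjes_measure Fc.

Let lsE x y : x <= y -> ls `]x, y]%classic = (F y - F x)%:E.
Proof.
move=> xy; rewrite /ls /= /lebesgue_stieltjes_measure /measure_extension measurable_mu_extE /=;
  last exact: is_ocitv.
by rewrite wlength_itv_bnd.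
Qed.

Let mab : measurable (`]a, b] : set (measurableTypeR R)).
Proof. exact: measurable_itv. Qed.

Let lsab : (ls `]a, b]%classic < +oo)%E.
Proof. by rewrite lsE ?ltry // ltW. Qed.

Let nu := mfrestr mab lsab.

(** The endpoint [b] is treated apart: [nu] lives on a half-open interval, whereas [ls_open]
    concerns open subsets of the open one. *)
Let ls_right (e : R) : 0 < e -> (ls [set b] <= e%:E)%E.
Proof.
move=> /(ac_unif acF)[d d0 H].
pose c := Num.max a (b - d / 2).
have cb : c < b by rewrite /c gt_max ab /=; lra.
have ac : a <= c by rewrite /c le_max lexx.
apply: (@le_trans _ _ (ls `]c, b]%classic)).
  apply: le_measure; rewrite ?inE //.
  by move=> z /= ->; rewrite in_itv /= lexx cb.
rewrite (lsE (ltW cb)) lee_fin; apply: le_trans (ler_norm _) _; apply/ltW/H.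
- by rewrite lexx ltW.
- by rewrite ac ltW.
- rewrite ger0_norm; last by lra.
  by have : b - d / 2 <= c by [rewrite /c le_max lexx orbT]; lra.
Qed.

(* The components of an open set of small Lebesgue measure form a disjoint family
   of intervals of small total length. *)
Let ls_open (e : R) : 0 < e -> exists2 d : R, 0 < d &
  forall U, open U -> U `<=` `]a, b[ -> (mu U < d%:E)%E -> (ls U <= e%:E)%E.
Proof.
move=> /acF[d d0 H]; exists d => // U oU Uab Ud.
pose J := open_disjoint_itv oU.
have JU i : J i `<=` U by rewrite [U](open_disjoint_itv_bigcup oU) => z Jz; exists i.
have mJ i : measurable (J i) by apply: open_measurable; exact: open_disjoint_itv_open.
have mU : measurable U by exact: open_measurable.
have ends i : exists p : R * R, [/\ a <= p.1, p.1 <= p.2, p.2 <= b & J i = `]p.1, p.2[%classic].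
  have [->|/set0P[z Jz]] := eqVneq (J i) set0.
    exists (a, a); split => //=; first exact: ltW.
    by rewrite set_itv_ge // bnd_simp ltxx.
  have lb : lbound (J i) a.
    by move=> y /JU/Uab; rewrite /= in_itv /= => /andP[/ltW].
  have ub : ubound (J i) b.
    by move=> y /JU/Uab; rewrite /= in_itv /= => /andP[_ /ltW].
  have hi : has_inf (J i) by split; [exists z|exists a].
  have hs : has_sup (J i) by split; [exists z|exists b].
  exists (inf (J i), sup (J i)); split => /=.
  - by apply: lb_le_inf => //; exists z.
  - by apply: (@le_trans _ _ z); [exact: (ge_inf hi.2 Jz)|exact: (ub_le_sup hs.2 Jz)].
  - by apply: ge_sup => //; exists z.
  have oJ : open (J i) by exact: open_disjoint_itv_open.
  have itvJ : is_interval (J i) by exact: open_disjoint_itv_is_interval.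
  rewrite -{1}((interior_id _).1 oJ) (interval_bounded_interior itvJ hi.2 hs.2).
  by apply/seteqP; split => y /=; rewrite in_itv.
have [p pP] := choice ends.
have -> : U = \bigcup_i J i by exact: open_disjoint_itv_bigcup.
have trJ : trivIset setT J by exact: open_disjoint_itv_trivIset.
rewrite measure_bigcup //; last by move=> i _; exact: mJ.
apply: lime_le; first by apply: is_cvg_nneseries => i _ _; exact: measure_ge0.
apply: nearW => n.
apply: (@le_trans _ _ (\sum_(0 <= i < n) (F (p i).2 - F (p i).1))%:E).
  rewrite -sumEFin; under eq_bigl do rewrite in_setT; apply: lee_sum => i _.
  have [_ p12 _ ->] := pP i; rewrite -lsE //; apply: le_measure; rewrite ?inE //.
  exact: subset_itv_oo_oc.
rewrite lee_fin; apply/ltW; rewrite big_mkord.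
apply: (@le_lt_trans _ _ (\sum_(i < n) `|F (p i).2 - F (p i).1|)).
  by apply: ler_sum => i _; exact: ler_norm.
apply: (H n (fun i => (p i).1) (fun i => (p i).2)).
- by move=> k; have [] := pP k.
- apply/trivIsetP => i j _ _ ij; move/trivIsetP: trJ => /(_ i j Logic.I Logic.I ij).
  by have [_ _ _ ->] := pP i; have [_ _ _ ->] := pP j.
- rewrite -lte_fin; apply: le_lt_trans Ud.
  rewrite -sumEFin.
  have -> : (\sum_(i < n) ((p i).2 - (p i).1)%:E = \sum_(i < n) mu (J i))%E.
    apply: eq_bigr => i _; have [_ p12 _ ->] := pP i.
    transitivity (mu `](p i).1, (p i).2[%classic); last by [].
    rewrite lebesgue_measure_itv /= lte_fin; case: ltP => h; first by rewrite EFinB.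
    by have -> : (p i).2 = (p i).1 by [lra]; rewrite subrr.
  rewrite -(measure_bigsetU mu mJ trJ n).
  apply: le_measure; [apply/mem_set|exact/mem_set|].
    by apply: bigsetU_measurable => i _; exact: mJ.
  by move=> z; rewrite -bigcup_mkord => -[i _]; exact: JU.
Qed.

(** By outer regularity the part of a null set inside the open interval lies in open sets of
    arbitrarily small Lebesgue measure, to which [ls_open] applies; [ls_right] takes care of [b]. *)
Let nu_dom : nu `<< mu.
Proof.
apply/null_content_dominatesP => A mA A0.
apply/eqP; rewrite eq_le measure_ge0 andbT; apply/lee_addgt0Pr => e e0; rewrite add0e.
have [d d0 Hd] := ls_open (divr_gt0 e0 (ltr0n R 2)).
pose A' := A `&` `]a, b[.
have mA' : measurable A' by apply: measurableI.
have A'0 : mu A' = 0.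
  apply/eqP; rewrite eq_le measure_ge0 andbT -A0; apply: le_measure; rewrite ?inE //.
  by move=> z [].
have A'oo : (mu A' < +oo)%E by rewrite A'0.
have [U [oU A'U UA']] := lebesgue_regularity_outer mA' A'oo d0.
have mU : measurable U by exact: open_measurable.
pose U' := U `&` `]a, b[.
have oU' : open U' by apply: openI => //; exact: itv_open.
have mU' : measurable U' by exact: open_measurable.
have U'd : (mu U' < d%:E)%E.
  apply: le_lt_trans UA'; rewrite -[leRHS]adde0 -A'0.
  apply: (@le_trans _ _ (mu ((U `\` A') `|` A'))).
    apply: le_measure; rewrite ?inE //; first by apply: measurableU => //; exact: measurableD.
    by move=> z [Uz _]; case: (pselect (A' z)) => h; [right|left].
  by apply: measureU2 => //; exact: measurableD.
have {}Hd := Hd _ oU' (@subIsetr _ _ _) U'd.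
have eb := ls_right (divr_gt0 e0 (ltr0n R 2)).
rewrite [e]splitr EFinD; apply: le_trans (leeD Hd eb).
apply: (@le_trans _ _ (ls (U' `|` [set b]))).
  rewrite /nu /mfrestr /mrestr.
  apply: le_measure; rewrite ?inE //; [exact: measurableI|exact: measurableU|].
  move=> z [Az]; rewrite /= in_itv /= => /andP[az].
  rewrite le_eqVlt => /orP[/eqP zb|zb]; [by right|left].
  have Iz : `]a, b[%classic z by rewrite /= in_itv /= az.
  by split => //; exact: A'U.
by apply: measureU2.
Qed.

Lemma nondecreasing_ac_density : exists2 h, locint h &
  forall x y, a <= x -> x <= y -> y <= b -> F y - F x = I h x y.
Proof.
have [f [f0 ffin fint fE]] := radon_nikodym_sigma_finite nu_dom.
have fK : EFin \o (fine \o f) = f by apply/funext => z /=; rewrite fineK.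
have lh : locint (fine \o f).
  split=> [|c d]; last by rewrite fK; exact: integrableS fint.
  by apply: measurableT_comp => //; exact: measurable_int fint.
exists (fine \o f) => // x y ax xy yb.
rewrite /I -(Rintegral_itv_obnd_cbnd (r := x)); last first.
  by apply: (integrableS _ _ _ (lh.2 x y)) => //; apply: subset_itvScc; rewrite bnd_simp.
rewrite /Rintegral; under eq_integral do rewrite /= fineK //.
rewrite -fE; last exact: measurable_itv.
have E : nu `]x, y]%classic = ls `]x, y]%classic.
  rewrite /nu /= /mfrestr /mrestr setIidl //.
  by move=> z /=; rewrite !in_itv /= => /andP[xz zy]; apply/andP; split; lra.
by transitivity (fine (nu `]x, y]%classic)); first by rewrite E lsE.
Qed.

End Nondecreasing.

Lemma ac_clip a b f : abs_continuous a b f -> abs_continuous a b (f \o clip a b).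
Proof.
move=> acf e /acf[d d0 H]; exists d => // n x y xy tr /(H _ _ _ xy tr).
apply: le_lt_trans; apply: ler_sum => k _ /=; have [? ? ?] := xy k.
by rewrite !clip_id //; apply/andP; split; lra.
Qed.

Lemma clip_clip a b x : a <= b -> clip a b (clip a b x) = clip a b x.
Proof. by move=> ab; rewrite clip_id // clip_itv. Qed.

(** Jordan decomposition [f = V - (V - f)] with [V] the variation from [a]: both terms are
    nondecreasing and absolutely continuous. Composition with [clip a b] makes them monotone on the
    whole line, as a Stieltjes measure requires. *)
Lemma ac_density a b f : a < b -> abs_continuous a b f -> exists2 h, locint h &
  forall x y, a <= x -> x <= y -> y <= b -> f y - f x = I h x y.
Proof.
move=> ab acf; have ab' := ltW ab.
have bv := ac_bounded_variation acf ab'.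
pose V x := fine (total_variation a x f).
have acV : abs_continuous a b V by exact: ac_total_variation.
have VB x y : a <= x -> x <= y -> y <= b -> `|f y - f x| <= V y - V x.
  move=> ax xy yb; rewrite /V (total_variationD f ax xy).
  have fin u v : a <= u -> u <= v -> v <= b -> total_variation u v f \is a fin_num.
    move=> au uv vb; apply/bounded_variationP => //.
    apply: (bounded_variationl uv vb); apply: (bounded_variationr au _ bv); lra.
  have xb : x <= b by lra.
  rewrite fineD ?fin // [leRHS]addrC addKr -lee_fin fineK ?fin //.
  exact: total_variation_ge.
have ndW (W : R -> R) : (forall x y, a <= x -> x <= y -> y <= b -> W x <= W y) ->
    {homo W \o clip a b : x y / x <= y}.
  move=> H x y xy /=; have /andP[? ?] := clip_itv x ab'; have /andP[? ?] := clip_itv y ab'.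
  by apply: H => //; exact: clip_le.
have den (W : R -> R) : (forall x y, a <= x -> x <= y -> y <= b -> W x <= W y) ->
    abs_continuous a b W -> exists2 h, locint h &
    forall x y, a <= x -> x <= y -> y <= b -> W y - W x = I h x y.
  move=> /ndW nd /ac_clip ac.
  have cc x : (W \o clip a b) x = (W \o clip a b) (clip a b x) by rewrite /= clip_clip.
  have [h lh H] := nondecreasing_ac_density ab nd ac cc.
  exists h => // x y ax xy yb; rewrite -H //= !clip_id //; apply/andP; split; lra.
have [x y ax xy yb|h1 lh1 H1] := den V _ acV.
  by have := VB x y ax xy yb; have := normr_ge0 (f y - f x); lra.
have [x y ax xy yb|h2 lh2 H2] := den (fun x => V x - f x) _ (acB acV acf).
  by have := VB x y ax xy yb; have := ler_norm (f y - f x); lra.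
exists (fun x => h1 x - h2 x); first exact: locintB.
by move=> x y ax xy yb; rewrite IB // -H1 // -H2 //; lra.
Qed.

Lemma ac_derive1_le a b f g : locint g -> a <= b -> abs_continuous a b f ->
  {ae mu, forall t, a < t < b -> derive1 f t <= g t} -> f b - f a <= I g a b.
Proof.
move=> lg; rewrite le_eqVlt => /predU1P[<-|ab] acf fg; first by rewrite subrr I_refl.
have [h lh H] := ac_density ab acf.
rewrite (H a b (lexx _) (ltW ab) (lexx _)); apply: le_I_oo => //.
have := ae_is_derive_I_itv lh H; apply: aeS2 fg => t Ht H' tab.
have := Ht tab; have D := H' tab.
by rewrite derive1E (@derive_val _ _ _ _ _ _ _ D).
Qed.

End ACDensity.

(** * Borel representatives of operators *)

Section AeIntegral.
Context d (T : measurableType d) (R : realType) (mu : {measure set T -> \bar R}).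
Import HBNNSimple.

(** A simple function below [f], set to zero on a null set containing all points where [f] and [g]
    differ, lies below [g] and keeps its integral. *)
Let ge0_ae_le_integral (f g : T -> \bar R) : (forall t, 0 <= f t)%E -> (forall t, 0 <= g t)%E ->
  {ae mu, forall t, f t = g t} -> (\int[mu]_t f t <= \int[mu]_t g t)%E.
Proof.
move=> f0 g0 [N [mN N0 fgN]].
rewrite (ge0_integralTE _ f0) (ge0_integralTE _ g0).
apply: ge_ereal_sup => _ [h hf <-].
pose h' := mul_nnsfun h (indic_nnsfun R (measurableC mN)).
have hE : sintegral mu h = sintegral mu h'.
  rewrite -!integralT_nnsfun; apply: ae_eq_integral => //.
  - exact/measurable_EFinP.
  - exact/measurable_EFinP.
  exists N; split => // t /= ht; apply: contrapT => Nt; apply: ht => _ /=.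
  by rewrite mindicE mem_set //= mulr1.
rewrite hE; apply: ereal_sup_ubound; exists h' => // t /=.
rewrite mindicE; case: (pselect (N t)) => Nt.
  by rewrite memNset /= ?mulr0 // => /(_ Nt).
rewrite mem_set //= mulr1; apply: (le_trans (hf t)).
by have <- : f t = g t by [apply: contrapT => ?; apply: Nt; exact: fgN].
Qed.

(* No measurability is required: the integral of a nonnegative function is a
   supremum over the simple functions below it. *)
Lemma ae_integral (D : set T) (f1 f2 : T -> \bar R) :
  {ae mu, forall t, D t -> f1 t = f2 t} ->
  (\int[mu]_(t in D) f1 t = \int[mu]_(t in D) f2 t)%E.
Proof.
have nn_eq (f g : T -> \bar R) : (forall t, 0 <= f t)%E -> (forall t, 0 <= g t)%E ->
    {ae mu, forall t, f t = g t} -> (\int[mu]_t f t = \int[mu]_t g t)%E.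
  move=> f0 g0 fg; apply/eqP; rewrite eq_le !ge0_ae_le_integral //.
  by apply: filterS fg => t ->.
move=> f12; rewrite integral_mkcond [RHS]integral_mkcond.
rewrite integralE [RHS]integralE; congr (_ - _)%E; apply: nn_eq => //.
- by apply: filterS f12 => t H; rewrite !funeposE !patchE; case: ifP => // /set_mem /H ->.
- by apply: filterS f12 => t H; rewrite !funenegE !patchE; case: ifP => // /set_mem /H ->.
Qed.

End AeIntegral.

Section Representatives.
Context {R : realType}.
Implicit Types (a b t : R) (g h u v : R -> R) (T F : (R -> R) -> R -> R).
Notation mu := (@lebesgue_measure R).

(** Representatives on growing intervals are glued along the shells [E n]; the [n]-th one is valid
    up to absolute value [n.+1] and so covers its shell. On a given interval the glued function
    inherits integrability from an integrable representative there. *)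
Lemma Lloc_locint g : Lloc setT g ->
  exists2 h, locint h & {ae mu, forall t, g t = h t}.
Proof.
move=> Lg.
have /choice[k kP] : forall n : nat, exists k : R -> R,
    mu.-integrable `[- n.+1%:R, n.+1%:R] (EFin \o k) /\
    {ae mu, forall t, - n.+1%:R <= t <= n.+1%:R -> g t = k t}.
  move=> n; have [||k ik gk] := Lg (- n.+1%:R) n.+1%:R.
  - by have := ler0n R n.+1; lra.
  - exact: subsetT.
  by exists k.
pose h t := k (Num.trunc `|t|) t.
have gh : {ae mu, forall t, g t = h t}.
  have /ae_nat : forall n, {ae mu, forall t, - n.+1%:R <= t <= n.+1%:R -> g t = k n t}.
    by move=> n; exact: (kP n).2.
  apply: aeS => t H; apply: (H (Num.trunc `|t|)).
  by rewrite -ler_norml ltW // truncnS_gt.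
pose E n : set R := Num.norm @^-1` `[n%:R, n.+1%:R[.
have mE n : measurable (E n).
  rewrite -[E n]setTI; apply: normr_measurable => //; exact: measurable_itv.
have TE : \bigcup_n E n = setT.
  rewrite -subTset => t _; exists (Num.trunc `|t|) => //; rewrite /E /= in_itv /=.
  exact: truncn_itv.
have mh : measurable_fun setT h.
  rewrite -TE; apply/measurable_fun_bigcup => // n.
  apply: (@eq_measurable_fun _ _ _ _ _ (k n)).
    move=> t /set_mem; rewrite /E /= in_itv /= => /andP[h1 h2].
    by rewrite /h (truncn_def (n := n)) // h1.
  have [ik _] := kP n; have /measurable_EFinP := measurable_int mu ik.
  apply: measurable_funS => //.
  move=> t; rewrite /E /= !in_itv /= => /andP[_ h2]; rewrite -ler_norml; exact: ltW.
exists h => //; split => // a b.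
have [ba|ab] := ltP b a; first by rewrite set_itv_ge ?bnd_simp -?ltNge //; exact: integrable_set0.
have [|l il gl] := Lg a b ab; first exact: subsetT.
apply/integrableP; split; first exact/measurable_funTS/measurable_EFinP.
have /integrableP[_ +] := il.
apply: le_lt_trans; rewrite le_eqVlt; apply/orP; left; apply/eqP.
by apply: ae_integral; apply: aeS2 gl gh => t /= H1 H2 tab; rewrite -H1 // H2.
Qed.

(* On continuous functions this is continuity from C_loc to L_loc; the function
   [K, d] describes a neighbourhood of [u] in C_loc. *)
Definition opcont F := forall u, continuous u -> forall a b (e : R), a <= b -> 0 < e ->
  exists K d : R, 0 < d /\ forall v, continuous v ->
    (forall t, - K <= t <= K -> `|v t - u t| <= d) -> I (fun t => `|F v t - F u t|) a b <= e.

(** The sets [B (K, d)] generate a filter that converges to [u] uniformly on every compact set,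
    since such a set lies in some [[- K, K]]. Hence the filter contains every neighbourhood of
    [u]. *)
Lemma nbhs_family_compact u (A : set {family compact, R -> R}) :
  nbhs (u : {family compact, R -> R}) A ->
  exists K d : R, 0 < d /\
    forall v : R -> R, (forall t, - K <= t <= K -> `|v t - u t| <= d) -> A v.
Proof.
pose B (p : R * R) := [set v : R -> R | forall t, - p.1 <= t <= p.1 -> `|v t - u t| <= p.2].
pose G := filter_from [set p : R * R | 0 < p.2] B.
have FG : Filter G.
  apply: filter_from_filter; first by exists (0, 1) => /=.
  move=> [K d] [K' d'] /= d0 d'0; exists (Num.max K K', Num.min d d').
    by rewrite /= lt_min d0.
  move=> v /= H; split => t /= tK.
    have := H t; rewrite le_min => /(_ _)/andP[] //.
    by move: tK; rewrite /= -!ler_norml le_max => ->.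
  have := H t; rewrite le_min => /(_ _)/andP[] //.
  by move: tK; rewrite /= -!ler_norml le_max => ->; rewrite orbT.
have : G --> (u : {family compact, R -> R}).
  rewrite -fam_cvgE; apply/fam_cvgP => C cC P /uniform_nbhs[E [entE subP]].
  have [M [_ HM]] := compact_bounded cC.
  have [e /= e0 eE] : exists2 e : R, 0 < e & forall x y : R, `|x - y| < e -> E (x, y).
    move: entE; rewrite -entourage_ballE => -[e /= e0 eE]; exists e => // x y xy.
    by apply: eE => /=.
  exists (`|M| + 1, e / 2) => /=; first exact: divr_gt0.
  move=> v /= H; apply: subP => t Ct; apply: eE; rewrite distrC.
  apply: (@le_lt_trans _ _ (e / 2)); last by lra.
  by apply: (H t); rewrite /= -ler_norml; apply: HM => //; have := ler_norm M; lra.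
move=> H /H [[K d] /= d0 HA]; exists K, d; split => // v Hv; exact: HA.
Qed.

Lemma operator_representative T : continuous_operator T -> exists F,
  (forall u, continuous u -> locint (F u) /\ {ae mu, forall t, T u t = F u t}) /\ opcont F.
Proof.
move=> [LT cT].
have /choice[F FP] : forall u, exists h, continuous u ->
    locint h /\ {ae mu, forall t, T u t = h t}.
  move=> u; have [cu|] := pselect (continuous u); last by exists 0.
  by have [h lh Th] := Lloc_locint (LT u cu); exists h.
exists F; split => // u cu a b e ab e0.
have : nbhs (0%E : \bar R) [set x | (x < e%:E)%E].
  by apply: open_nbhs_nbhs; split; [exact: open_ereal_lt_ereal|rewrite /= lte_fin].
move/(cT u cu a b ab); rewrite /= => /nbhs_family_compact[K [d [d0 H]]].
exists K, d; split => // v cv uv.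
have {}H := H v uv cv.
have [lu Tu] := FP u cu; have [lv Tv] := FP v cv.
have lB := locint_abs (locintB lv lu).
rewrite -lee_fin /I /Rintegral fineK; last exact: integrable_fin_num (lB.2 a b).
apply: le_trans (ltW H); rewrite le_eqVlt; apply/orP; left; apply/eqP.
by apply: ae_integral; apply: aeS2 Tu Tv => t -> ->.
Qed.

End Representatives.

(** * Limits along an ultrafilter *)

Section Ultralimits.
Context {R : realType}.
Implicit Types (a b s t x e : R) (g h u v : R -> R).
Notation mu := (@lebesgue_measure R).
Variable G : set_system nat.
Context {ultraG : UltraFilter G}.

(** Compactness gives a cluster point [l]. If the indices with [z n] close to [l] did not form a set
    of [G], the complement would, and the values there would stay away from [l]. *)
Lemma ultra_bounded_limit (z : nat -> R) (C : R) : G [set n | `|z n| <= C] ->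
  exists l, forall e, 0 < e -> G [set n | `|z n - l| <= e].
Proof.
move=> GC; have PG : ProperFilter (fmap z G) by exact: fmap_proper_filter.
have GI : G (z @^-1` `[- C, C]).
  by apply: filterS GC => n /=; rewrite ler_norml in_itv.
have [l [_ cl]] := @segment_compact _ (- C) C (fmap z G) PG GI.
exists l => e e0; have [//|GA] := in_ultra_setVsetC [set n | `|z n - l| <= e] ultraG.
have [|y [ye yb]] := cl [set y | ~ (`|y - l| <= e)] (ball l e) GA.
  exact: nbhsx_ballx.
by case: ye; rewrite distrC; exact: ltW yb.
Qed.

Lemma ultra_le (z : nat -> R) l (C : R) : (forall e, 0 < e -> G [set n | `|z n - l| <= e]) ->
  G [set n | z n <= C] -> l <= C.
Proof.
move=> zl zC; apply/ler_addgt0Pr => e e0.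
have [n [/= h1 h2]] := filter_ex (filterI (zl e e0) zC).
by move: h1; rewrite ler_norml => /andP[h3 _]; lra.
Qed.

Lemma ultra_ge (z : nat -> R) l (C : R) : (forall e, 0 < e -> G [set n | `|z n - l| <= e]) ->
  G [set n | C <= z n] -> C <= l.
Proof.
move=> zl zC; apply/ler_addgt0Pr => e e0.
have [n [/= h1 h2]] := filter_ex (filterI (zl e e0) zC).
by move: h1; rewrite ler_norml => /andP[_ h3]; lra.
Qed.

Definition lucvg (u : nat -> R -> R) v := forall B e, 0 < e ->
  G [set n | forall t, - B <= t <= B -> `|u n t - v t| <= e].

Lemma lucvg_pt (u : nat -> R -> R) v t e : lucvg u v -> 0 < e -> G [set n | `|u n t - v t| <= e].
Proof. by move=> uv e0; apply: filterS (uv `|t| e e0) => n; apply; rewrite -ler_norml. Qed.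

(* Arzela-Ascoli: the modulus of continuity [I g] is common to all [u n], [n] large. *)
Lemma ultra_limit (u : nat -> R -> R) (t1 C : R) :
  (forall B, exists2 g, locint g &
    G [set n | forall s t, - B <= s -> s <= t -> t <= B -> `|u n t - u n s| <= I g s t]) ->
  G [set n | `|u n t1| <= C] ->
  exists2 v : R -> R, continuous v & lucvg u v.
Proof.
move=> H GC.
have /choice[v vP] : forall t, exists l, forall e, 0 < e -> G [set n | `|u n t - l| <= e].
  move=> t; pose B := Num.max `|t| `|t1|; have [g lg Hg] := H B.
  have /andP[tB tB'] : - B <= t <= B by rewrite -ler_norml le_max lexx.
  have /andP[t1B t1B'] : - B <= t1 <= B by rewrite -ler_norml le_max lexx orbT.
  pose M := Num.max (I g t t1) (I g t1 t).
  apply: (@ultra_bounded_limit _ (C + M)); apply: filterS2 GC Hg => n h1 h2 /=.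
  have : `|u n t - u n t1| <= M.
    rewrite /M le_max; case: (leP t t1) => [tt1|/ltW tt1].
      by rewrite distrC h2.
    by rewrite (h2 t1 t) ?orbT.
  have := ler_normD (u n t1) (u n t - u n t1).
  have -> : u n t1 + (u n t - u n t1) = u n t by ring.
  by move: h1 => /=; lra.
have vB B g : locint g ->
    G [set n | forall s t, - B <= s -> s <= t -> t <= B -> `|u n t - u n s| <= I g s t] ->
    forall s t, - B <= s -> s <= t -> t <= B -> `|v t - v s| <= I g s t.
  move=> lg Hg s t Bs st tB; apply/ler_addgt0Pr => e e0.
  have e2 : 0 < e / 2 by lra.
  have [n [/= h1 [h2 h3]]] := filter_ex (filterI Hg (filterI (vP s _ e2) (vP t _ e2))).
  have := h1 s t Bs st tB.
  have -> : v t - v s = (u n t - u n s) + ((u n s - v s) - (u n t - v t)) by ring.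
  have := ler_normD (u n t - u n s) ((u n s - v s) - (u n t - v t)).
  have := ler_normB (u n s - v s) (u n t - v t); lra.
have Ig g s t : locint g -> I g s t <= I (fun x => `|g x|) s t.
  by move=> lg; apply: le_trans (ler_norm _) _; exact: I_abs.
exists v.
  move=> t; apply/cvgrPdist_le => e e0.
  have [g lg Hg] := H (`|t| + 1); have vg := vB _ _ lg Hg.
  have [d d0 Hd] := I_unif (- (`|t| + 1)) (`|t| + 1) lg e0.
  pose d' := Num.min d 1.
  have d'0 : 0 < d' by rewrite lt_min d0 ltr01.
  have key a b : - (`|t| + 1) <= a -> a <= b -> b <= `|t| + 1 -> b - a < d -> `|v b - v a| <= e.
    move=> h1 h2 h3 h4; apply: (le_trans (vg _ _ h1 h2 h3)).
    exact: le_trans (Ig _ _ _ lg) (ltW (Hd _ _ h1 h2 h3 h4)).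
  near=> s.
  have : `|t - s| < d' by near: s; exact: cvgr_dist_lt.
  rewrite lt_min => /andP[]; rewrite !ltr_norml => /andP[s1 s2] /andP[s3 s4].
  have tt := ler_norm t; have tt' := ler_norm (- t); rewrite normrN in tt'.
  by case: (leP s t) => [st|/ltW st]; [|rewrite distrC]; apply: key; lra.
move=> B e e0; have [g lg Hg] := H B; have vg := vB _ _ lg Hg.
have e3 : 0 < e / 3 by lra.
have [d d0 Hd] := I_unif (- B) B lg e3.
have d2 : 0 < d / 2 by lra.
(* A grid of mesh [d / 2] from [- B]: each [t] has a node [p k] less than [d] to its left, and
   convergence at the finitely many nodes is simultaneous along [G]. *)
pose m := (Num.trunc (2 * B / (d / 2))).+1.
pose p i := - B + i%:R * (d / 2).
have Gp : G [set n | forall i : 'I_m, `|u n (p i) - v (p i)| <= e / 3].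
  by apply: filter_forall => i; exact: vP.
apply: filterS2 Gp Hg => n /= h1 h2 t /andP[Bt tB].
pose k := Num.trunc ((t + B) / (d / 2)).
have /andP[k1 k2] : k%:R <= (t + B) / (d / 2) < k.+1%:R.
  by apply: truncn_itv; rewrite divr_ge0 ?(ltW d2) //; lra.
have km : (k < m)%N.
  rewrite ltnS; apply: le_truncn; rewrite ler_wpM2r ?invr_ge0 ?(ltW d2) //; lra.
rewrite ler_pdivlMr // in k1; rewrite ltr_pdivrMr // -natr1 mulrDl mul1r in k2.
have := h1 (Ordinal km); rewrite /= => h3.
have b1 : - B <= p k by rewrite /p lerDl mulr_ge0 // (ltW d2).
have b2 : p k <= t by rewrite /p; lra.
have b3 : t - p k < d by rewrite /p; lra.
have h4 := h2 _ _ b1 b2 tB; have h5 := vg _ _ b1 b2 tB.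
have := Hd _ _ b1 b2 tB b3; have := Ig _ (p k) t lg.
have -> : u n t - v t = (u n t - u n (p k)) + ((u n (p k) - v (p k)) - (v t - v (p k))) by ring.
have := ler_normD (u n t - u n (p k)) ((u n (p k) - v (p k)) - (v t - v (p k))).
have := ler_normB (u n (p k) - v (p k)) (v t - v (p k)); lra.
Unshelve. all: by end_near. Qed.

End Ultralimits.

(** * Volterra operators and Tonelli's scheme *)

Section VolterraOperators.
Context {R : realType}.
Implicit Types (a b s t x e : R) (g h u v : R -> R) (F H : (R -> R) -> R -> R).
Notation mu := (@lebesgue_measure R).

Definition volterra F := forall zeta u v, continuous u -> continuous v ->
  (forall t, t <= zeta -> u t = v t) -> {ae mu, forall t, t <= zeta -> F u t = F v t}.

Definition volterra_op F :=
  [/\ forall u, continuous u -> locint (F u), opcont F & volterra F].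

Definition sol F u a b := forall s t, a <= s -> s <= t -> t <= b -> u t - u s = I (F u) s t.

Lemma volterra_opB F H : volterra_op F -> volterra_op H ->
  volterra_op (fun u t => F u t - H u t).
Proof.
move=> [lF cF vF] [lH cH vH]; split.
- by move=> u cu; apply: locintB; [exact: lF|exact: lH].
- move=> u cu a b e ab e0; have e2 : 0 < e / 2 by lra.
  have [K [d [d0 HF]]] := cF u cu a b _ ab e2; have [K' [d' [d'0 HH]]] := cH u cu a b _ ab e2.
  exists (Num.max K K'), (Num.min d d'); split; first by rewrite lt_min d0.
  move=> v cv uv; have := HF v cv; have := HH v cv => h1 h2.
  have {}h1 : I (fun t => `|H v t - H u t|) a b <= e / 2.
    apply: h1 => t; rewrite -ler_norml => tK; have := uv t.
    by rewrite -ler_norml le_max tK orbT le_min => /(_ isT)/andP[].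
  have {}h2 : I (fun t => `|F v t - F u t|) a b <= e / 2.
    apply: h2 => t; rewrite -ler_norml => tK; have := uv t.
    by rewrite -ler_norml le_max tK le_min => /(_ isT)/andP[].
  have l1 := locint_abs (locintB (lF v cv) (lF u cu)).
  have l2 := locint_abs (locintB (lH v cv) (lH u cu)).
  apply: (@le_trans _ _ (I (fun t => `|F v t - F u t| + `|H v t - H u t|) a b)).
    apply: le_I; [|exact: locintD|].
      by apply: locint_abs; apply: locintB; apply: locintB; auto.
    apply: aeT => t _; have -> : F v t - H v t - (F u t - H u t) =
      (F v t - F u t) - (H v t - H u t) by ring.
    exact: ler_normB.
  by rewrite ID //; lra.
- move=> z u v cu cv uv; apply: aeS2 (vF z u v cu cv uv) (vH z u v cu cv uv) => t h1 h2 tz.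
  by rewrite h1 // h2.
Qed.

Lemma volterra_opN F : volterra_op F -> volterra_op (fun u t => - F u t).
Proof.
move=> [lF cF vF]; split.
- move=> u cu; have -> : (fun t => - F u t) = (fun t => -1 * F u t).
    by apply/funext => t; rewrite mulN1r.
  exact/locintZ/lF.
- move=> u cu a b e ab e0; have [K [d [d0 HF]]] := cF u cu a b _ ab e0.
  exists K, d; split => // v cv uv; have := HF v cv uv.
  have -> // : (fun t => `|- F v t - - F u t|) = (fun t => `|F v t - F u t|).
  apply/funext => t; rewrite -normrN; congr `|_|; ring.
- by move=> z u v cu cv uv; apply: aeS (vF z u v cu cv uv) => t h tz; rewrite h.
Qed.

Lemma volterra_opD F H : volterra_op F -> volterra_op H ->
  volterra_op (fun u t => F u t + H u t).
Proof.
move=> vF /volterra_opN vH; have := volterra_opB vF vH.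
by congr volterra_op; apply/funext => u; apply/funext => t; rewrite opprK.
Qed.

(** Nonexpansive for the supremum over a window of length [r] into the past. Truncations ([r = 0])
    and delays ([r = d]) are of this kind, and composing with them preserves [volterra_op]. *)
Definition causal_map (X : (R -> R) -> R -> R) := exists2 r : R, 0 <= r &
  (forall u, continuous u -> continuous (X u)) /\
  forall u v t e, (forall s, t - r <= s <= t -> `|v s - u s| <= e) -> `|X v t - X u t| <= e.

Lemma volterra_op_comp F X : causal_map X -> volterra_op F -> volterra_op (fun u => F (X u)).
Proof.
move=> [r r0 [cX lX]] [lF cF vF]; split.
- by move=> u /cX; exact: lF.
- move=> u cu a b e ab e0; have [K [d [d0 HF]]] := cF _ (cX u cu) a b _ ab e0.
  exists (K + r), d; split => // v cv uv; apply: HF; first exact: cX.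
  by move=> t tK; apply: lX => s ts; apply: uv; lra.
- move=> z u v cu cv uv; apply: vF; [exact: cX|exact: cX|].
  move=> t tz; apply/eqP; rewrite -subr_eq0 -normr_le0; apply: lX => s ts.
  by rewrite uv ?subrr ?normr0 //; lra.
Qed.

Lemma clip_continuous (lo hi : R) : continuous (clip lo hi).
Proof.
move=> s; apply/cvgrPdist_lt => e e0; near=> z.
apply: le_lt_trans (clip_lip _ _ _ _) _.
by near: z; exact: cvgr_dist_lt.
Unshelve. all: by end_near. Qed.

(** The summand [psi] equips an unknown of constant history with a prescribed one:
    [forward_extension] uses the given history minus its value at [t0]. Up to [t0] the truncations
    have [psi = 0]. *)
Definition shift_clip (lo hi : R) (psi u : R -> R) t := clip lo hi (u t + psi t).

Lemma shift_clip_causal lo hi psi : continuous psi -> causal_map (shift_clip lo hi psi).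
Proof.
move=> cpsi; exists 0 => //; split.
  move=> u cu t; apply: (@continuous_comp _ _ _ (fun t => u t + psi t) (clip lo hi)).
    by apply: cvgD; [exact: cu|exact: cpsi].
  exact: clip_continuous.
move=> u v t e H; rewrite /shift_clip; apply: le_trans (clip_lip _ _ _ _) _.
have -> : v t + psi t - (u t + psi t) = v t - u t by ring.
by apply: H; lra.
Qed.

Definition delay (d : R) u t := u (t - d).

Lemma delay_continuous d u : continuous u -> continuous (delay d u).
Proof.
move=> cu t; apply: continuous_comp; last exact: cu.
by apply: cvgB; [exact: cvg_id|exact: cvg_cst].
Qed.

Lemma delay_causal d : 0 <= d -> causal_map (delay d).
Proof.
move=> d0; exists d => //; split; first by move=> u; exact: delay_continuous.
by move=> u v t e H; apply: H; rewrite lexx lerBlDr lerDl.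
Qed.

Lemma I_max_continuous h a : locint h -> continuous (fun t => I h a (Num.max a t)).
Proof.
move=> lh t; apply/cvgrPdist_le => e e0.
have [d d0 Hd] := I_unif a (`|t| + `|a| + 1) lh e0.
pose d' := Num.min d 1.
have d'0 : 0 < d' by rewrite lt_min d0 ltr01.
have key x y : a <= x -> x <= y -> y <= `|t| + `|a| + 1 -> y - x < d ->
    `|I h a y - I h a x| <= e.
  move=> h1 h2 h3 h4; rewrite (I_chasles lh h1 h2) addrAC subrr add0r.
  exact: le_trans (I_abs _ _ lh) (ltW (Hd _ _ h1 h2 h3 h4)).
near=> s.
have : `|t - s| < d' by near: s; exact: cvgr_dist_lt.
rewrite lt_min => /andP[]; rewrite !ltr_norml => /andP[s1 s2] /andP[s3 s4].
have tt := ler_norm t; have aa := ler_norm a; have t0 := normr_ge0 t; have a0 := normr_ge0 a.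
case: (leP s t) => [st|/ltW st]; [|rewrite distrC].
  apply: key; [by rewrite le_max lexx|exact: le_max2| |].
    by rewrite ge_max; apply/andP; split; lra.
  by case: (leP a t) => ?; case: (leP a s) => ?; lra.
apply: key; [by rewrite le_max lexx|exact: le_max2| |].
  by rewrite ge_max; apply/andP; split; lra.
by case: (leP a t) => ?; case: (leP a s) => ?; lra.
Unshelve. all: by end_near. Qed.

Section Tonelli.
Variables (F : (R -> R) -> R -> R) (g : R -> R).
Hypotheses (vF : volterra_op F) (lg : locint g)
  (Fg : forall u, continuous u -> {ae mu, forall t, `|F u t| <= g t}).
Variables (a d : R).
Hypothesis d0 : 0 < d.

(** Since [F] sees only a function delayed by [d], the [k]-th iterate is final up to [a + k%:R * d]
    ([tonelliS]) and solves the delayed equation exactly between [a] and that time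
    ([tonelli_eq]). *)
Fixpoint tonelli x k : R -> R := if k is k'.+1 then
    fun t => x + I (F (delay d (tonelli x k'))) a (Num.max a t)
  else fun=> x.

Let vdF : volterra_op (fun u => F (delay d u)).
Proof. by apply: volterra_op_comp => //; apply: delay_causal; exact: ltW. Qed.

Let tonelliE x k t :
  tonelli x k.+1 t = x + I (F (delay d (tonelli x k))) a (Num.max a t).
Proof. by []. Qed.

Lemma tonelli_continuous x k : continuous (tonelli x k).
Proof.
elim: k => [|k IH] t /=; first exact: cvg_cst.
apply: cvgD; first exact: cvg_cst.
by apply: I_max_continuous; have [l _ _] := vdF; exact: l.
Qed.

Lemma tonelli_const x k t : t <= a -> tonelli x k t = x.
Proof. by case: k => //= k ta; rewrite (max_idPl ta) I_refl addr0. Qed.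

Lemma tonelliS x k t : t <= a + k%:R * d -> tonelli x k.+1 t = tonelli x k t.
Proof.
elim: k t => [|k IH] t; first by rewrite mul0r addr0 => ta; rewrite !tonelli_const.
move=> tk; have [ta|at_] := leP t a; first by rewrite !tonelli_const.
rewrite tonelliE [RHS]tonelliE; congr (_ + _); have [l _ v] := vF.
have cd j : continuous (delay d (tonelli x j)).
  by apply: delay_continuous; exact: tonelli_continuous.
apply: eq_I_ae; [by apply: l; exact: cd|by apply: l; exact: cd|].
have : {ae mu, forall s, s <= t ->
    F (delay d (tonelli x k.+1)) s = F (delay d (tonelli x k)) s}.
  apply: v; [exact: cd|exact: cd|] => s st; apply: IH.
  by move: tk; rewrite -natr1 mulrDl mul1r; lra.
by apply: aeS => s Hs /andP[_ sm]; apply: Hs; move: sm; rewrite (max_idPr (ltW at_)).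
Qed.

Lemma tonelli_eq x k T : T <= a + k%:R * d -> forall s t, a <= s -> s <= t -> t <= T ->
  tonelli x k t - tonelli x k s = I (F (delay d (tonelli x k))) s t.
Proof.
move=> Tk s t as_ st tT.
have sT : s <= a + k%:R * d by lra.
have tT' : t <= a + k%:R * d by lra.
have at_ : a <= t by lra.
rewrite -(tonelliS x sT) -(tonelliS x tT') !tonelliE (max_idPr as_) (max_idPr at_).
rewrite (I_chasles _ as_ st); last by have [l _ _] := vdF; apply: l; exact: tonelli_continuous.
ring.
Qed.

(** As [g] dominates [F] at every continuous function, the modulus is independent of the delay, the
    datum and the number of iterations; this is the source of compactness. *)
Lemma tonelli_modulus x k s t : s <= t -> `|tonelli x k t - tonelli x k s| <= I g s t.
Proof.
have g0 : {ae mu, forall t, 0 <= g t}.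
  apply: aeS (Fg (@cst_continuous _ _ 0)) => z; exact: le_trans.
have Ig p q : 0 <= I g p q by apply: I_ge0 => //; apply: aeS g0.
move=> st; case: k => [|k] /=; first by rewrite subrr normr0.
have [l _ _] := vdF; have lk := l _ (@tonelli_continuous x k).
have [ta|at_] := leP t a.
  by rewrite (max_idPl (le_trans st ta)) subrr normr0.
set m := Num.max a s.
have am : a <= m by rewrite le_max lexx.
have sm : s <= m by rewrite le_max lexx orbT.
have mt : m <= t by rewrite ge_max st ltW.
rewrite (I_chasles lk am mt) opprD addrACA subrr add0r addrAC subrr add0r.
apply: le_trans (I_abs _ _ lk) _.
apply: (@le_trans _ _ (I g m t)); last by rewrite (I_chasles lg sm mt) lerDr.
apply: le_I => //; first exact: locint_abs.
apply: aeS (Fg (delay_continuous (@tonelli_continuous x k))) => z + _; exact.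
Qed.

(** For fixed [d] and [k] the scheme is a finite composition of continuous maps, so it depends
    continuously on the datum even if the equation without delay has several solutions. *)
Lemma tonelli_continuous_init k x K e : 0 < e -> exists2 eta : R, 0 < eta &
  forall y, `|y - x| <= eta -> forall t, - K <= t <= K -> `|tonelli y k t - tonelli x k t| <= e.
Proof.
elim: k K e => [|k IH] K e e0; first by exists e.
have [l c _] := vdF; have e2 : 0 < e / 2 by lra.
pose K' := Num.max a K.
have aK : a <= K' by rewrite le_max lexx.
have [K1 [d1 [d10 H1]]] := c _ (@tonelli_continuous x k) a K' _ aK e2.
have [eta eta0 Heta] := IH K1 d1 d10.
exists (Num.min eta (e / 2)); first by rewrite lt_min eta0.
move=> y; rewrite le_min => /andP[y1 y2] t /andP[Kt tK] /=.
have ly := l _ (@tonelli_continuous y k); have lx := l _ (@tonelli_continuous x k).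
set m := Num.max a t.
have am : a <= m by rewrite le_max lexx.
have mK : m <= K' by rewrite /m /K' ge_max aK le_max tK orbT.
have -> : forall p q, y + p - (x + q) = (y - x) + (p - q) by move=> p q; ring.
rewrite -IB //; apply: le_trans (ler_normD _ _) _.
have := H1 _ (@tonelli_continuous y k) (Heta _ y1).
have lxy := locintB ly lx; have la := locint_abs lxy.
have := I_abs a m lxy.
have : I (fun z => `|F (delay d (tonelli y k)) z - F (delay d (tonelli x k)) z|) a m <=
    I (fun z => `|F (delay d (tonelli y k)) z - F (delay d (tonelli x k)) z|) a K'.
  by apply: le_I_itv => //; apply: aeT.
lra.
Qed.

End Tonelli.

End VolterraOperators.

(** * Limits of the delayed approximations: Cauchy problem and shooting *)

Section Existence.
Context {R : realType}.
Implicit Types (a b s t x e : R) (g h u v w : R -> R) (F H : (R -> R) -> R -> R).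
Notation mu := (@lebesgue_measure R).

Section Limits.
Variable G : set_system nat.
Context {ultraG : UltraFilter G}.

Lemma limit_sol F (u v : nat -> R -> R) w a b :
  volterra_op F -> lucvg G u w -> lucvg G v w -> continuous w -> (forall n, continuous (v n)) ->
  G [set n | forall s t, a <= s -> s <= t -> t <= b -> u n t - u n s = I (F (v n)) s t] ->
  sol F w a b.
Proof.
move=> [lF cF _] uw vw cw cv Hn s t as_ st tb.
apply/eqP; rewrite -subr_eq0 -normr_le0; apply/ler_addgt0Pr => e e0.
have e4 : 0 < e / 4 by lra.
have [K [d [d0 HF]]] := cF w cw s t _ st e4.
have [n [/= h1 [h2 [h3 h4]]]] := filter_ex (filterI Hn (filterI (lucvg_pt t uw e4)
  (filterI (lucvg_pt s uw e4) (vw K d d0)))).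
have h5 := HF _ (cv n) h4; have h6 := h1 s t as_ st tb.
have l1 := lF _ (cv n); have l2 := lF _ cw.
have := I_abs s t (locintB l1 l2); rewrite IB // => h7.
rewrite add0r.
have -> : w t - w s - I (F w) s t =
  (I (F (v n)) s t - I (F w) s t) - ((u n t - w t) - (u n s - w s)) by rewrite -h6; ring.
have := ler_normB (I (F (v n)) s t - I (F w) s t) ((u n t - w t) - (u n s - w s)).
have := ler_normB (u n t - w t) (u n s - w s); move: h2 h3; lra.
Qed.

Lemma lucvg_delay (u : nat -> R -> R) w g (d : nat -> R) : locint g -> lucvg G u w ->
  (forall n s t, s <= t -> `|u n t - u n s| <= I g s t) ->
  (forall n, 0 <= d n) -> (forall e, 0 < e -> G [set n | d n < e]) ->
  lucvg G (fun n => delay (d n) (u n)) w.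
Proof.
move=> lg uw ug d0 dG B e e0; have e2 : 0 < e / 2 by lra.
have [eta eta0 H] := I_unif (- B - 1) B lg e2.
have eta1 : 0 < Num.min eta 1 by rewrite lt_min eta0 ltr01.
apply: filterS2 (uw B _ e2) (dG _ eta1) => n /= h1.
rewrite lt_min => /andP[h2 h3] t /andP[Bt tB].
have dn := d0 n; have h4 : t - d n <= t by lra.
have h5 : - B - 1 <= t - d n by lra.
have h6 : t - (t - d n) < eta by lra.
have := H _ _ h5 h4 tB h6; have := ug n _ _ h4; have := h1 t; rewrite Bt tB => /(_ isT).
have := I_abs (t - d n) t lg; have := ler_norm (I g (t - d n) t).
have -> : delay (d n) (u n) t - w t = (u n t - w t) - (u n t - u n (t - d n)).
  by rewrite /delay; ring.
have := ler_normB (u n t - w t) (u n t - u n (t - d n)); lra.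
Qed.

End Limits.

Section TonelliLimit.
Variables (F : (R -> R) -> R -> R) (g : R -> R).
Hypotheses (vF : volterra_op F) (lg : locint g)
  (Fg : forall u, continuous u -> {ae mu, forall t, `|F u t| <= g t}).
Variables (a T : R).
Hypothesis aT : a <= T.

Let dn (n : nat) : R := n.+1%:R^-1.
(** Enough iterations for steps of length [dn n] to lead from [a] to [T]. *)
Let kn (n : nat) : nat := (Num.trunc ((T - a) * n.+1%:R)).+1.

Let dn_gt0 n : 0 < dn n. Proof. by rewrite /dn invr_gt0. Qed.

Let kn_ge n : T <= a + (kn n)%:R * dn n.
Proof.
rewrite -lerBlDl /dn ler_pdivlMr ?ltr0n //.
by apply/ltW; rewrite /kn truncnS_gt.
Qed.

Let approx x n := tonelli F a (dn n) x (kn n).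

Let approx_continuous x n : continuous (approx x n).
Proof. exact: (tonelli_continuous vF (dn_gt0 n)). Qed.

Let tonelli_limit (G : set_system nat) (ultraG : UltraFilter G) (x : nat -> R) (X : R) :
  \oo `<=` G -> (forall n, `|x n| <= X) ->
  exists2 u : R -> R, continuous u & [/\ lucvg G (fun n => approx (x n) n) u, sol F u a T &
    forall t, t <= a -> u t = u a].
Proof.
move=> ooG xX.
have mod_ n s t : s <= t -> `|approx (x n) n t - approx (x n) n s| <= I g s t.
  exact: (tonelli_modulus vF lg Fg a (dn_gt0 n)).
have [||u cu uG] := @ultra_limit _ G ultraG (fun n => approx (x n) n) a X.
- by move=> B; exists g => //; apply: filterE => n s t _ st _; exact: mod_.
- by apply: filterE => n /=; rewrite /approx tonelli_const.
exists u => //; split => //; last first.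
  move=> t ta; apply/eqP; rewrite -subr_eq0 -normr_le0; apply/ler_addgt0Pr => e e0.
  have e2 : 0 < e / 2 by lra.
  have [n [/= h1 h2]] := filter_ex (filterI (lucvg_pt t uG e2) (lucvg_pt a uG e2)).
  move: h1 h2; rewrite /approx !tonelli_const // => h1 h2; rewrite add0r.
  have -> : u t - u a = (x n - u a) - (x n - u t) by ring.
  by have := ler_normB (x n - u a) (x n - u t); lra.
apply: (limit_sol vF uG _ cu) => [|n|].
- apply: (lucvg_delay lg uG mod_) => [n|e e0]; first exact: ltW (dn_gt0 n).
  by apply: ooG; have := near_infty_natSinv_lt (PosNum e0).
- by apply: delay_continuous; exact: approx_continuous.
- apply: filterE => n s t as_ st tT.
  exact: (tonelli_eq vF (dn_gt0 n) (x n) (kn_ge n)).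
Qed.

Lemma cauchy_problem x : exists2 u : R -> R, continuous u &
  (forall t, t <= a -> u t = x) /\ sol F u a T.
Proof.
have [G [ultraG ooG]] := ultraFilterLemma (@eventually_filter : ProperFilter \oo).
have [u cu [uG us ua]] := tonelli_limit ultraG ooG (fun=> lexx `|x|).
exists u => //; split => // t /ua ->; apply/eqP; rewrite -subr_eq0 -normr_le0.
apply/ler_addgt0Pr => e e0; rewrite add0r.
have [n /=] := filter_ex (lucvg_pt a uG e0).
by rewrite /approx tonelli_const // distrC.
Qed.

(** The hypothesis on solutions from [X] does not concern a single approximation, which may still
    end below [c]; then the datum [X] is kept. If this occurred on a set of the ultrafilter, the
    limit would start at [X] and end at most at [c], a contradiction. Otherwise the intermediate
    value theorem supplies approximations ending exactly at [c]. *)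
Lemma shooting (X c : R) : 0 <= X -> 0 <= c ->
  {ae mu, forall t, t <= T -> F (fun=> 0) t = 0} ->
  (forall u, continuous u -> (forall t, t <= a -> u t = X) -> sol F u a T -> c < u T) ->
  exists2 u : R -> R, continuous u &
    [/\ forall t, t <= a -> u t = u a, 0 <= u a <= X, sol F u a T & u T = c].
Proof.
move=> X0 c0 F0 HX.
have [G [ultraG ooG]] := ultraFilterLemma (@eventually_filter : ProperFilter \oo).
have zero k n t : t <= T -> tonelli F a (dn n) 0 k t = 0.
  elim: k t => [//|k IH] t tT /=; rewrite add0r.
  have [l _ v] := vF; set u := delay _ _.
  have cu : continuous u by apply: delay_continuous; exact: (tonelli_continuous vF (dn_gt0 n)).
  have m : Num.max a t <= T by rewrite ge_max aT.
  rewrite (@eq_I_ae _ _ (fun=> 0)); first by rewrite /I Rintegral_cst // mul0r.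
  - exact: l.
  - exact: locint_cst.
  - have := v T u (fun=> 0) cu (@cst_continuous _ _ 0).
    move=> /(_ _)/(aeS2 _ F0); apply.
      by move=> s h1 h2 /andP[_ sm]; rewrite h2 ?h1 // (le_trans sm m).
    by move=> s sT; rewrite /u /delay IH //; have := dn_gt0 n; lra.
have /choice[x xP] : forall n, exists x, 0 <= x <= X /\
    (approx x n T = c \/ (x = X /\ approx x n T <= c)).
  move=> n; have [h|h] := leP (approx X n T) c.
    by exists X; split; [rewrite X0 lexx|right].
  have cont : continuous (fun x => approx x n T).
    move=> x; apply/cvgrPdist_le => e e0.
    have [eta eta0 Heta] := tonelli_continuous_init vF a (dn_gt0 n) (kn n) x `|T| e0.
    near=> y; rewrite distrC; apply: Heta; last by rewrite -ler_norml.
    by rewrite distrC; apply/ltW; near: y; exact: cvgr_dist_lt.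
  have [||x] := @IVT _ (fun x => approx x n T) 0 X c X0.
  - exact: continuous_subspaceT.
  - rewrite /approx zero //; rewrite ge_min c0 /= le_max.
    by rewrite -/(approx X n T) (ltW h) orbT.
  - by rewrite in_itv /= => x0X xc; exists x; split => //; left.
have xX n : `|x n| <= X by have [/andP[h1 h2] _] := xP n; rewrite ger0_norm.
have [u cu [uG us ua]] := tonelli_limit ultraG ooG xX.
have xu e : 0 < e -> G [set n | `|x n - u a| <= e].
  by move=> e0; apply: filterS (lucvg_pt a uG e0) => n /=; rewrite /approx tonelli_const.
have [GA|GA] := in_ultra_setVsetC [set n | approx (x n) n T = c] ultraG.
  exists u => //; split => //.
    apply/andP; split; [apply: (ultra_ge xu)|apply: (ultra_le xu)]; apply: filterE => n /=;
      by have [/andP[]] := xP n.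
  apply/eqP; rewrite -subr_eq0 -normr_le0; apply/ler_addgt0Pr => e e0; rewrite add0r.
  have [n [/= h1 h2]] := filter_ex (filterI (lucvg_pt T uG e0) GA).
  by rewrite distrC -h2.
have GX : G [set n | x n = X /\ approx (x n) n T <= c].
  by apply: filterS GA => n /= h; have [_ [//|]] := xP n.
have uX : u a = X.
  apply/eqP; rewrite -subr_eq0 -normr_le0; apply/ler_addgt0Pr => e e0; rewrite add0r.
  have [n [/= h1 [h2 _]]] := filter_ex (filterI (xu _ e0) GX).
  by rewrite distrC -[in X in `|X - _|]h2.
have : u T <= c.
  apply: (ultra_le (z := fun n => approx (x n) n T)); last by apply: filterS GX => n [].
  by move=> e e0; exact: (lucvg_pt T uG e0).
by rewrite leNgt HX // => t /ua ->.
Unshelve. all: by end_near. Qed.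

End TonelliLimit.

End Existence.

(** * Gronwall's inequality and positive operators *)

Section Gronwall.
Context {R : realType}.
Implicit Types (a b s t r e Z : R) (P z : R -> R).

Lemma itv_chain (S : R -> R -> Prop) a b (d : R) : 0 < d ->
  (forall s t, a <= s -> s <= t -> t <= b -> t - s <= d -> S s t) ->
  (forall s r t, a <= s -> s <= r -> r <= t -> t <= b -> S s r -> S r t -> S s t) ->
  a <= b -> S a b.
Proof.
move=> d0 loc tr ab.
have H n t : a <= t -> t <= b -> t - a <= n.+1%:R * d -> S a t.
  elim: n t => [|n IH] t at_ tb tn; first by apply: loc => //; rewrite mul1r in tn.
  pose r := Num.max a (t - d).
  have ar : a <= r by rewrite le_max lexx.
  have rt : r <= t by rewrite ge_max at_ /=; lra.
  have rd : t - d <= r by rewrite le_max lexx orbT.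
  apply: (tr a r t) => //; last by apply: loc => //; lra.
  apply: IH => //; first exact: le_trans rt tb.
  move: tn; rewrite -[n.+2%:R]natr1 mulrDl mul1r /r.
  case: (leP a (t - d)) => h tn; last by rewrite subrr mulr_ge0 // ltW.
  lra.
apply: (H (Num.trunc ((b - a) / d))) => //.
by rewrite -ler_pdivrMr // ltW // truncnS_gt.
Qed.

(** The hypothesis reads [(1 - p) * S <= x], and the product of [1 - p] and [1 + (1 + e) * p] is
    [1 + p * (e - p * (1 + e))], hence at least 1. *)
Lemma gronwall_step (S x p e : R) : 0 < e -> 0 <= p -> p * (1 + e) <= e -> 0 <= S ->
  S <= x + p * S -> S <= x * (1 + (1 + e) * p).
Proof.
move=> e0 p0 pe S0 Sx.
have c0 : 0 <= 1 + (1 + e) * p by rewrite addr_ge0 // mulr_ge0 // addr_ge0 // ltW.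
have Sx' : (1 - p) * S <= x by lra.
have h1 := ler_wpM2r c0 Sx'.
have h2 : 0 <= S * (p * (e - p * (1 + e))) by rewrite !mulr_ge0 // subr_ge0.
lra.
Qed.

(** Where [P] grows by less than [e / (1 + e)], the supremum of [z] is absorbed at the price of a
    factor at most [expR ((1 + e) * p)], [p] being the growth. Such intervals are chained, and [e]
    tends to 0. Boundedness of [z] suffices, no continuity. *)
Lemma gronwall P z a b (C : R) : a <= b ->
  (forall s t, a <= s -> s <= t -> t <= b -> P s <= P t) ->
  (forall e, 0 < e -> exists2 d : R, 0 < d &
     forall s t, a <= s -> s <= t -> t <= b -> t - s < d -> P t - P s < e) ->
  (forall t, a <= t <= b -> 0 <= z t <= C) ->
  (forall s t Z, a <= s -> s <= t -> t <= b -> (forall r, s <= r <= t -> z r <= Z) ->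
     z s <= z t + (P t - P s) * Z) ->
  z a <= z b * expR (P b - P a).
Proof.
move=> ab ndP ucP z0C H.
have step e : 0 < e -> z a <= z b * expR ((1 + e) * (P b - P a)).
  move=> e0; have e1 : 0 < e / (1 + e) by rewrite divr_gt0 // addr_gt0.
  have [d d0 Hd] := ucP _ e1.
  apply: (@itv_chain (fun s t => z s <= z t * expR ((1 + e) * (P t - P s))) a b (d / 2)) => //.
  - lra.
  - move=> s t as_ st tb tsd.
    have pi0 : 0 <= P t - P s by rewrite subr_ge0 ndP.
    have pie : P t - P s < e / (1 + e) by apply: Hd => //; lra.
    set p := P t - P s in pi0 pie *.
    pose A := [set z r | r in [set r | s <= r <= t]].
    have hA : has_sup A.
      split; first by exists (z s), s => //=; rewrite lexx.
      exists C => _ [r /= sr <-]; have /z0C/andP[] // : a <= r <= b by lra.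
    have zZ r : s <= r <= t -> z r <= sup A by move=> sr; apply: (ub_le_sup hA.2); exists r.
    have zs0 : 0 <= z s by have /z0C/andP[] // : a <= s <= b by lra.
    have Z0 : 0 <= sup A by apply: le_trans zs0 (zZ _ _); rewrite lexx.
    (* The hypothesis is used from every [r] in [[s, t]] to the same right end [t]. *)
    have Zle : sup A <= z t + p * sup A.
      apply: ge_sup; first exact: hA.1.
      move=> _ [r /= /andP[sr rt] <-].
      have ar : a <= r by lra.
      apply: (le_trans (H r t (sup A) ar rt tb _)).
        by move=> r' /andP[? ?]; apply: zZ; lra.
      by rewrite lerD2l ler_wpM2r // /p lerB // ndP //; lra.
    have p1 : p < 1 by apply: lt_le_trans pie _; rewrite ler_pdivrMr ?addr_gt0 //; lra.
    apply: (le_trans (zZ s _)); first by rewrite lexx.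
    have ex : 1 + (1 + e) * p <= expR ((1 + e) * p) by exact: expR_ge1Dx.
    have zt0 : 0 <= z t by have /z0C/andP[] // : a <= t <= b by lra.
    apply: (@le_trans _ _ (z t * (1 + (1 + e) * p))); last exact: ler_wpM2l.
    have pe : p * (1 + e) <= e by rewrite -ler_pdivlMr ?addr_gt0 // ltW.
    exact: (gronwall_step e0 pi0 pe Z0 Zle).
  - move=> s r t as_ sr rt tb h1 h2; apply: (le_trans h1).
    have -> : (1 + e) * (P t - P s) = (1 + e) * (P t - P r) + (1 + e) * (P r - P s) by ring.
    by rewrite expRD mulrA ler_wpM2r // expR_ge0.
rewrite leNgt; apply/negP => lt.
have cont : z b * expR ((1 + e) * (P b - P a)) @[e --> (0 : R)^'+] --> z b * expR (P b - P a).
  apply: cvg_at_right_filter.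
  have E : P b - P a = (1 + 0) * (P b - P a) by rewrite addr0 mul1r.
  rewrite {2}E.
  apply: cvgM; first exact: cvg_cst.
  apply: continuous_cvg; first exact: continuous_expR.
  apply: cvgM; last exact: cvg_cst.
  by apply: cvgD; [exact: cvg_cst|exact: cvg_id].
near (0 : R)^'+ => e.
have e0 : 0 < e by near: e; exact: nbhs_right_gt.
have : z b * expR ((1 + e) * (P b - P a)) < z a by near: e; exact: cvgr_lt cont _ lt.
by rewrite ltNge step.
Unshelve. all: by end_near. Qed.

End Gronwall.

Section PositiveLinear.
Context {R : realType}.
Implicit Types (a b s t r e m zeta : R) (u v : R -> R) (L : (R -> R) -> R -> R).
Notation mu := (@lebesgue_measure R).

Definition poslin L := [/\ volterra_op L,
  forall a u v, continuous u -> continuous v ->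
    {ae mu, forall t, L (fun s => a * u s + v s) t = a * L u t + L v t} &
  forall u, continuous u -> (forall t, 0 <= u t) -> {ae mu, forall t, 0 <= L u t}].

Variable L : (R -> R) -> R -> R.
Hypothesis plL : poslin L.

Let lin a u v : continuous u -> continuous v ->
  {ae mu, forall t, L (fun s => a * u s + v s) t = a * L u t + L v t}.
Proof. by have [_ l _] := plL; exact: l. Qed.

Lemma stop_continuous zeta u : continuous u -> continuous (fun t => u (Num.min t zeta)).
Proof.
move=> cu t; apply: continuous_comp; last exact: cu.
by apply: continuous_min; [exact: cvg_id|exact: cvg_cst].
Qed.

Lemma poslin0 : {ae mu, forall t, L (fun=> 0) t = 0}.
Proof.
have := @lin 1 _ _ (@cst_continuous _ _ 0) (@cst_continuous _ _ 0).
apply: aeS => t; rewrite mulr0 addr0 mul1r; lra.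
Qed.

Lemma poslinZ m u : continuous u -> {ae mu, forall t, L (fun s => m * u s) t = m * L u t}.
Proof.
move=> cu; apply: aeS2 poslin0 (@lin m _ _ cu (@cst_continuous _ _ 0)) => t h.
rewrite h addr0 => <-; congr (L _ t); apply/funext => s; by rewrite addr0.
Qed.

(** Positivity speaks of functions nonnegative on the whole line. The difference stopped at [zeta]
    is such a function, and the Volterra property makes the stopping invisible up to [zeta]. *)
Lemma poslin_le zeta u v : continuous u -> continuous v ->
  (forall t, t <= zeta -> u t <= v t) -> {ae mu, forall t, t <= zeta -> L u t <= L v t}.
Proof.
move=> cu cv uv; have [[_ _ vL] _ pL] := plL.
have cw : continuous (fun t => -1 * u t + v t).
  by move=> t; apply: cvgD; [apply: cvgM; [exact: cvg_cst|exact: cu]|exact: cv].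
pose w' t := -1 * u (Num.min t zeta) + v (Num.min t zeta).
have cw' : continuous w' by exact: (stop_continuous (zeta := zeta) cw).
have h0 : {ae mu, forall t, 0 <= L w' t}.
  apply: pL => // t; have : Num.min t zeta <= zeta by rewrite ge_min lexx orbT.
  by rewrite /w'; move=> /uv; lra.
have h1 : {ae mu, forall t, t <= zeta -> L w' t = L (fun t => -1 * u t + v t) t}.
  by apply: vL => // t tz; rewrite /w' (min_idPl tz).
apply: aeS3 (@lin (-1) _ _ cu cv) h0 h1 => t h3 h4 h5 tz.
by move: h4; rewrite h5 // h3; lra.
Qed.

Lemma poslin_ge0 zeta u : continuous u -> (forall t, t <= zeta -> 0 <= u t) ->
  {ae mu, forall t, t <= zeta -> 0 <= L u t}.
Proof.
move=> cu u0; apply: aeS2 poslin0 (poslin_le (@cst_continuous _ _ 0) cu u0) => t h1 h2 tz.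
by rewrite -h1 h2.
Qed.

Lemma poslin_le_scale zeta m u v : continuous u -> continuous v ->
  (forall t, t <= zeta -> u t <= m * v t) -> {ae mu, forall t, t <= zeta -> L u t <= m * L v t}.
Proof.
move=> cu cv uv.
have cm : continuous (fun t => m * v t) by move=> t; apply: cvgM; [exact: cvg_cst|exact: cv].
by apply: aeS2 (poslinZ m cv) (poslin_le cu cm uv) => t <-.
Qed.

Lemma poslin_ge_scale zeta m u v : continuous u -> continuous v ->
  (forall t, t <= zeta -> m * v t <= u t) -> {ae mu, forall t, t <= zeta -> m * L v t <= L u t}.
Proof.
move=> cu cv uv.
have cm : continuous (fun t => m * v t) by move=> t; apply: cvgM; [exact: cvg_cst|exact: cv].
by apply: aeS2 (poslinZ m cv) (poslin_le cm cu uv) => t <-.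
Qed.

Lemma poslin_abs zeta m u : continuous u -> (forall t, t <= zeta -> `|u t| <= m) ->
  {ae mu, forall t, t <= zeta -> `|L u t| <= m * L (fun=> 1) t}.
Proof.
move=> cu um; have c1 := @cst_continuous R R 1.
have h1 : {ae mu, forall t, t <= zeta -> L u t <= m * L (fun=> 1) t}.
  by apply: poslin_le_scale => // t /um; rewrite ler_norml mulr1 => /andP[].
have h2 : {ae mu, forall t, t <= zeta -> - m * L (fun=> 1) t <= L u t}.
  by apply: poslin_ge_scale => // t /um; rewrite ler_norml mulr1 => /andP[].
by apply: aeS2 h1 h2 => t k1 k2 tz; rewrite ler_norml k1 // -mulNr k2.
Qed.

End PositiveLinear.

(** * Solutions up to t0 *)

Section HalfLine.
Context {R : realType}.
Notation mu := (@lebesgue_measure R).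
Variables (l0 l1 f : (R -> R) -> R -> R).
Hypotheses (pl0 : poslin l0) (pl1 : poslin l1) (vf : volterra_op f).
Variables (t0 kappa : R).
Hypothesis kappa0 : 0 < kappa.
Variable gam : R -> R.
Hypotheses (cgam : continuous gam) (gam0 : forall t, 0 < gam t)
  (gam_le : forall s t, s <= t -> t <= t0 -> I (l1 gam) s t <= gam s - gam t).

Definition rate t := l1 gam t / gam t.

Hypothesis rate_l0 : {ae mu, forall t, t <= t0 -> rate t <= l0 (fun=> 1) t}.
Variable sigma : R -> R.
Hypotheses (csigma : continuous sigma) (sigma_le : forall t, sigma t <= t)
  (l0_sigma : forall u v : R -> R, continuous u -> continuous v ->
     {ae mu, forall t, t <= t0 ->
       (forall s, sigma t <= s <= t -> u s = v s) -> l0 u t = l0 v t}).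
Variable M : R.
Hypothesis rate_M : forall t, t <= t0 -> I rate (sigma t) t <= M.
Hypotheses (f_ge0 : forall v : R -> R, continuous v -> (forall t, 0 <= v t <= kappa) ->
     {ae mu, forall t, t <= t0 -> 0 <= f v t})
  (f0 : {ae mu, forall t, t <= t0 -> f (fun=> 0) t = 0})
  (f_car : exists2 q, locint q & forall v : R -> R, continuous v -> (forall t, `|v t| <= kappa) ->
     {ae mu, forall t, `|f v t| <= q t}).

Let li0 u : continuous u -> locint (l0 u). Proof. by have [[l _ _] _ _] := pl0; exact: l. Qed.
Let li1 u : continuous u -> locint (l1 u). Proof. by have [[l _ _] _ _] := pl1; exact: l. Qed.
Let lif u : continuous u -> locint (f u). Proof. by have [l _ _] := vf; exact: l. Qed.

Let l1gam_ge0 : {ae mu, forall t, 0 <= l1 gam t}.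
Proof. by have [_ _ p] := pl1; apply: p => // t; exact: ltW. Qed.

Lemma rate_ge0 : {ae mu, forall t, 0 <= rate t}.
Proof. by apply: aeS l1gam_ge0 => t h; rewrite /rate divr_ge0 // ltW. Qed.

(** On a compact interval [gam] has a positive minimum, so [rate] is dominated there by a multiple
    of [l1 gam]. *)
Lemma locint_rate : locint rate.
Proof.
have [m1 i1] := li1 cgam.
have mrate : measurable_fun setT rate.
  apply: measurable_funM => //; apply: continuous_measurable_fun => t.
  by apply: cvgV; [rewrite gt_eqF|exact: cgam].
split=> // a b; have [ba|ab] := ltP b a.
  by rewrite set_itv_ge ?bnd_simp -?ltNge //; exact: integrable_set0.
have [x xab xmin] := EVT_min ab (continuous_subspaceT cgam).
apply: (@le_integrable _ _ _ mu _ _ _ (EFin \o (fun t => (gam x)^-1 * l1 gam t))) => //.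
- exact/measurable_funTS/measurable_EFinP.
- move=> t; rewrite /= in_itv /= => tab; rewrite lee_fin /rate !normrM mulrC ler_wpM2r //.
  rewrite !ger0_norm ?invr_ge0 ?(ltW (gam0 _)) // lef_pV2 ?posrE //.
  by apply: xmin; rewrite in_itv.
- exact: (locintZ _ (li1 cgam)).2.
Qed.

Let gam_noninc s t : s <= t -> t <= t0 -> gam t <= gam s.
Proof.
move=> st tt0; have := gam_le st tt0.
have : 0 <= I (l1 gam) s t by apply: I_ge0; [exact: li1|apply: aeS l1gam_ge0].
lra.
Qed.

(* [l0] and [l1] see [u] truncated at [N = 2 kappa], [f] sees it truncated at [kappa]. Hence a
   solution starting from [N] still exceeds [kappa * expR (- M)] at [t0], while the zero solution
   does not exceed [c]: shooting in between reaches [c]. *)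
Let N : R := kappa + kappa.
Let vv u := shift_clip 0 N (fun=> 0) u.
Let ck u := shift_clip 0 kappa (fun=> 0) u.
Let ft u t := l0 (vv u) t - l1 (vv u) t + f (ck u) t.

Let N0 : 0 <= N. Proof. by rewrite /N addr_ge0 // ltW. Qed.

Let vvE u t : vv u t = clip 0 N (u t). Proof. by rewrite /vv /shift_clip addr0. Qed.
Let ckE u t : ck u t = clip 0 kappa (u t). Proof. by rewrite /ck /shift_clip addr0. Qed.

Let vv_itv u t : 0 <= vv u t <= N. Proof. by rewrite vvE clip_itv. Qed.

Let cvv u : continuous u -> continuous (vv u).
Proof. by have [r r0 [c _]] := @shift_clip_causal R 0 N _ (@cst_continuous _ _ 0); exact: c. Qed.
Let cck u : continuous u -> continuous (ck u).
Proof. by have [r r0 [c _]] := @shift_clip_causal R 0 kappa _ (@cst_continuous _ _ 0); exact: c. Qed.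

Let vft : volterra_op ft.
Proof.
have [v0 _ _] := pl0; have [v1 _ _] := pl1.
apply: volterra_opD; first apply: volterra_opB.
- by apply: (volterra_op_comp _ v0); apply: shift_clip_causal; exact: cst_continuous.
- by apply: (volterra_op_comp _ v1); apply: shift_clip_causal; exact: cst_continuous.
- by apply: (volterra_op_comp _ vf); apply: shift_clip_causal; exact: cst_continuous.
Qed.

Let ft_bound : exists2 g, locint g & forall u, continuous u -> {ae mu, forall t, `|ft u t| <= g t}.
Proof.
have [q lq Hq] := f_car; have c1 := @cst_continuous R R 1.
exists (fun t => N * l0 (fun=> 1) t + N * l1 (fun=> 1) t + q t).
  by apply: locintD => //; apply: locintD; apply: locintZ; [exact: li0|exact: li1].
move=> u cu.
have h k : {ae mu, forall t, t <= k -> `|ft u t| <= N * l0 (fun=> 1) t + N * l1 (fun=> 1) t + q t}.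
  have b t : t <= k -> `|vv u t| <= N by have /andP[h1 h2] := vv_itv u t; rewrite ger0_norm.
  have ckk t : `|ck u t| <= kappa.
    have /andP[h1 h2] : 0 <= ck u t <= kappa by rewrite ckE clip_itv // ltW.
    by rewrite ger0_norm.
  apply: aeS3 (poslin_abs pl0 (cvv cu) b) (poslin_abs pl1 (cvv cu) b) (Hq _ (cck cu) ckk).
  move=> t h1 h2 h3 tk; have := h1 tk; have := h2 tk; rewrite /ft.
  have := ler_normD (l0 (vv u) t - l1 (vv u) t) (f (ck u) t).
  by have := ler_normB (l0 (vv u) t) (l1 (vv u) t); lra.
(* The operator bounds hold up to a fixed time; integer times exhaust the line with a single null
   set. *)
have /ae_nat := fun n : nat => h n%:R.
apply: aeS => t H; apply: (H (Num.trunc `|t|).+1).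
by apply: le_trans (ler_norm _) _; apply/ltW; exact: truncnS_gt.
Qed.

Section Estimates.
Variables (a : R) (u : R -> R).
Hypotheses (at0 : a <= t0) (cu : continuous u) (ua : forall t, t <= a -> u t = u a)
  (ua0 : 0 <= u a) (solu : sol ft u a t0).
Let v := vv u.
Let cv : continuous v. Proof. exact: cvv. Qed.

Let v_itv t : 0 <= v t <= N. Proof. exact: vv_itv. Qed.
Let v_ge0 t : 0 <= v t. Proof. by have /andP[] := v_itv t. Qed.
Let v_leN t : v t <= N. Proof. by have /andP[] := v_itv t. Qed.

Let v_pos t : 0 < v t -> v t <= u t.
Proof.
rewrite /v vvE /clip; case: (leP N (u t)) => h; first by rewrite (max_idPr N0).
by case: (leP 0 (u t)) => // h2 ; rewrite ?ltxx.
Qed.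

(** The nonnegative term [f (ck u)] is dropped. *)
Let ut_ge s t : a <= s -> s <= t -> t <= t0 ->
  u s + I (fun r => l0 v r - l1 v r) s t <= u t.
Proof.
move=> as_ st tt0; have := solu as_ st tt0.
have : I (fun r => l0 v r - l1 v r) s t <= I (ft u) s t.
  apply: le_I.
  - by apply: locintB; [exact: li0|exact: li1].
  - by have [l _ _] := vft; exact: l.
  apply: aeS (f_ge0 (cck cu) _) => [r h /andP[_ rt]|t']; last by rewrite ckE clip_itv // ltW.
  by rewrite /ft -/v; have := h (le_trans rt tt0); lra.
lra.
Qed.

(* At a maximum point [tau] of [v / gam] on [s <= t], one has [v <= m * gam] with
   [m = v tau / gam tau], so [u] decreases on [tau, t] at most as fast as [m * gam]. *)
Let ratio_nondec s t : s <= t -> t <= t0 -> v s * gam t <= v t * gam s.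
Proof.
move=> st tt0.
have [ta|at_] := leP t a.
  have -> : v s = v t by rewrite /v !vvE (ua ta) (ua (le_trans st ta)).
  by rewrite ler_wpM2l // gam_noninc.
have cw : continuous (fun r => v r / gam r).
  move=> r; apply: cvgM; first exact: cv.
  by apply: cvgV; [rewrite gt_eqF|exact: cgam].
have [tau + taumax] := EVT_max (ltW at_) (continuous_subspaceT cw).
rewrite in_itv /= => /andP[atau taut].
set m := v tau / gam tau in taumax.
have m0 : 0 <= m by rewrite divr_ge0 // ltW.
have vm r : r <= t -> v r <= m * gam r.
  move=> rt; rewrite -ler_pdivrMr //.
  have [ra|ar] := leP r a; last by apply: taumax; rewrite in_itv /= rt ltW.
  apply: (@le_trans _ _ (v a / gam a)).
    have -> : v r = v a by rewrite /v !vvE (ua ra).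
    rewrite ler_wpM2l // lef_pV2 ?posrE //; exact: gam_noninc ra at0.
  by apply: taumax; rewrite in_itv /= lexx ltW.
suff vt : m * gam t <= v t.
  apply: (@le_trans _ _ (m * gam s * gam t)).
    by rewrite ler_wpM2r ?vm // ltW.
  by rewrite mulrAC ler_wpM2r // ltW.
have [v0|vpos] := leP (v tau) 0.
  have -> : m = 0 by apply/eqP; rewrite /m mulf_eq0; have := v_ge0 tau; rewrite eq_le v0 => ->.
  by rewrite mul0r.
have h1 := ut_ge atau taut tt0.
have h2 : - m * I (l1 gam) tau t <= I (fun r => l0 v r - l1 v r) tau t.
  rewrite -IZ; last exact: li1.
  apply: le_I; [by apply: locintZ; exact: li1|by apply: locintB; [exact: li0|exact: li1]|].
  have v0' r : r <= t -> 0 <= v r by [].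
  apply: aeS2 (poslin_ge0 pl0 cv v0') (poslin_le_scale pl1 cv cgam vm) => r k1 k2 /andP[_ rt].
  by have := k1 rt; have := k2 rt; lra.
have h3 := ler_wpM2l m0 (gam_le taut tt0).
have h4 : m * gam tau = v tau by rewrite /m divfK // gt_eqF.
have h5 := v_pos vpos.
have h6 : m * gam t <= u t by lra.
(* The lower bound for [u t] passes to [v t], which is cut at [N], only because it does not exceed
   [N]. *)
have h7 : m * gam t <= N.
  by apply: le_trans (v_leN tau); rewrite -h4 ler_wpM2l // gam_noninc.
rewrite /v vvE /clip; case: (leP N (u t)) => k; first by rewrite (max_idPr N0).
by rewrite le_max h6 orbT.
Qed.

(** If [u t] were negative, [v t] would vanish, and by [ratio_nondec] so would [v] at all earlier
    times. Then [l1 v] contributes nothing, so [u] could not have dropped below [u a]. *)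
Lemma half_line_ge0 t : t <= t0 -> 0 <= u t.
Proof.
move=> tt0; rewrite leNgt; apply/negP => ut.
have [ta|at_] := leP t a; first by move: ut; rewrite (ua ta) ltNge ua0.
have vt : v t = 0.
  by rewrite /v vvE /clip; case: (leP N (u t)) => k; [have := N0; lra|rewrite (max_idPl (ltW ut))].
have vz s : s <= t -> v s = 0.
  move=> st; have := ratio_nondec st tt0; rewrite vt mul0r => h.
  by have := v_ge0 s; have := pmulr_lle0 (v s) (gam0 t); rewrite h => /esym; lra.
have h := ut_ge (lexx a) (ltW at_) tt0.
suff : 0 <= I (fun r => l0 v r - l1 v r) a t by move: ua0 ut h; lra.
apply: I_ge0; first by apply: locintB; [exact: li0|exact: li1].
have v0' r : r <= t -> 0 <= v r by [].
have v0'' r : r <= t -> v r <= 0 * 1 by move=> /vz ->; rewrite mul0r.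
have := @poslin_le_scale _ _ pl1 t 0 v (fun=> 1) cv (@cst_continuous R R 1) v0''.
apply: aeS2 (poslin_ge0 pl0 cv v0') => r k1 k2 /andP[_ rt].
by have := k1 rt; have := k2 rt; lra.
Qed.

(* Rational [zeta] suffice by continuity, and make the exceptional null set independent of [r]. *)
Let l1v_le : {ae mu, forall r, r < t0 -> l1 v r <= rate r * v r}.
Proof.
pose zeta n := Num.min t0 (ratr (odflt 0 (unpickle n : option rat))) : R.
have zt n : zeta n <= t0 by rewrite ge_min lexx.
have /ae_nat H n : {ae mu, forall r, r <= zeta n -> l1 v r <= (v (zeta n) / gam (zeta n)) * l1 gam r}.
  apply: (poslin_le_scale pl1 cv cgam) => r rz.
  by rewrite mulrAC ler_pdivlMr //; exact: ratio_nondec.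
apply: aeS2 H l1gam_ge0 => r H g0 rt0.
have -> : rate r * v r = v r / gam r * l1 gam r by rewrite /rate; ring.
rewrite leNgt; apply/negP => lt.
have cw : (v s / gam s * l1 gam r) @[s --> r^'+] --> v r / gam r * l1 gam r.
  apply: cvg_at_right_filter; apply: cvgM; last exact: cvg_cst.
  apply: cvgM; first exact: cv.
  by apply: cvgV; [rewrite gt_eqF|exact: cgam].
have : \forall s \near r^'+, v s / gam s * l1 gam r < l1 v r by exact: cvgr_lt cw _ lt.
move=> [d /= d0 Hd].
have [q] : exists q : rat, ratr q \in `]r, Num.min t0 (r + d)[%R.
  by apply: rat_in_itvoo; rewrite lt_min rt0 ltrDl.
rewrite in_itv /= lt_min => /andP[rq /andP[qt qd]].
have zq : zeta (pickle q) = ratr q by rewrite /zeta pickleK /= (min_idPr (ltW qt)).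
have := H (pickle q); rewrite zq => /(_ (ltW rq)); rewrite leNgt; apply/negP/negPn.
by apply: Hd => //=; rewrite /ball_ /= distrC ger0_norm ?subr_ge0 ?ltW //; lra.
Qed.

Let gronwall_rate (z : R -> R) (s t C : R) : s <= t ->
  (forall r, s <= r <= t -> 0 <= z r <= C) ->
  (forall s' t' Z, s <= s' -> s' <= t' -> t' <= t -> (forall r, s' <= r <= t' -> z r <= Z) ->
     z s' <= z t' + I rate s' t' * Z) ->
  z s <= z t * expR (I rate s t).
Proof.
move=> st zC H; have lr := locint_rate.
have PE s' t' : s <= s' -> s' <= t' -> I rate s t' - I rate s s' = I rate s' t'.
  by move=> h1 h2; rewrite (I_chasles lr h1 h2) addrAC subrr add0r.
have -> : I rate s t = I rate s t - I rate s s by rewrite I_refl subr0.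
apply: (gronwall (C := C)) => //.
- move=> s' t' h1 h2 h3; rewrite -subr_ge0 PE //.
  by apply: I_ge0 => //; apply: aeS rate_ge0.
- move=> e e0; have [d d0 Hd] := I_unif s t lr e0; exists d => // s' t' h1 h2 h3 h4.
  rewrite PE //; apply: le_lt_trans (Hd _ _ h1 h2 h3 h4).
  by apply: le_trans (ler_norm _) _; exact: I_abs.
- by move=> s' t' Z h1 h2 h3 h4; rewrite PE //; exact: H.
Qed.

(** With [l0 v] dropped and [l1 v] at most [rate] times [v], the loss of [u] is at most the integral
    of [rate] times a bound of [v]; [clip_shift] carries this over to [v]. *)
Let decay s t : a <= s -> s <= t -> t <= t0 -> v s <= v t * expR (I rate s t).
Proof.
move=> as_ st tt0; apply: (@gronwall_rate v s t N st) => // s' t' Z h1 h2 h3 vZ.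
have Z0 : 0 <= Z by apply: le_trans (v_ge0 s') (vZ _ _); rewrite lexx.
have r0 : 0 <= I rate s' t' by apply: I_ge0; [exact: locint_rate|apply: aeS rate_ge0].
rewrite /v !vvE; apply: clip_shift; first exact: mulr_ge0.
have := @ut_ge s' t' _ h2 _; move=> /(_ (le_trans as_ h1) (le_trans h3 tt0)).
have : - Z * I rate s' t' <= I (fun r => l0 v r - l1 v r) s' t'.
  rewrite -IZ; last exact: locint_rate.
  apply: le_I_oo.
  - exact/locintZ/locint_rate.
  - by apply: locintB; [exact: li0|exact: li1].
  have v0' r : r <= t0 -> 0 <= v r by [].
  apply: aeS3 (poslin_ge0 pl0 cv v0') l1v_le rate_ge0 => r k1 k2 k3 /andP[sr rt].
  have rt0 : r < t0 by lra.
  have := k1 (ltW rt0); have := k2 rt0.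
  have : rate r * v r <= rate r * Z by apply: ler_wpM2l => //; apply: vZ; rewrite !ltW.
  lra.
lra.
Qed.

(* Up to [t'], the last time with [sigma t' <= t1], the decay is controlled by [M]; from then on
   [sigma] stays above [t1], and [v] cannot go below its minimum on [t1, t']. *)
Let v_floor t1 t : a <= t1 -> t1 <= t -> t <= t0 -> v t1 * expR (- M) <= v t.
Proof.
move=> at1 t1t tt0; have lr := locint_rate.
pose T1 := [set r | t1 <= r <= t0 /\ sigma r <= t1].
have T1t1 : T1 t1 by split => //; rewrite lexx (le_trans t1t).
have hs : has_sup T1 by split; [exists t1|exists t0 => r [/andP[]]].
pose t' := sup T1.
have t1t' : t1 <= t' by exact: (ub_le_sup hs.2).
have t't0 : t' <= t0 by apply: ge_sup => [|r [/andP[]]//]; exists t1.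
(* Continuity of [sigma] makes the supremum a maximum. *)
have st' : sigma t' <= t1.
  rewrite leNgt; apply/negP => lt.
  have sc : sigma r @[r --> t'] --> sigma t' by exact: csigma.
  have [d /= d0 Hd] := cvgr_gt _ sc _ lt.
  have [r [/andP[r1 r2] r3] rd] := sup_adherent d0 hs.
  have rt' : r <= t' by apply: (ub_le_sup hs.2); split => //; apply/andP.
  have : t1 < sigma r by apply: Hd; rewrite /ball_ /= ger0_norm; rewrite ?subr_ge0 // /t' in rd *; lra.
  by rewrite ltNge r3.
have after r : t' < r -> r <= t0 -> t1 < sigma r.
  move=> t'r rt0; rewrite ltNge; apply/negP => sr.
  have : r <= t' by apply: (ub_le_sup hs.2); split => //; rewrite rt0 (le_trans t1t' (ltW t'r)).
  by rewrite leNgt t'r.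
have early r : t1 <= r -> r <= t' -> v t1 * expR (- M) <= v r.
  move=> t1r rt'; have h := decay at1 t1r (le_trans rt' t't0).
  have rM : I rate t1 r <= M.
    apply: le_trans (rate_M t't0); apply: le_I_itv => //; exact: rate_ge0.
  rewrite expRN ler_pdivrMr ?expR_gt0 //; apply: (le_trans h).
  by rewrite ler_wpM2l // ler_expR.
have [s + smin] := EVT_min t1t (continuous_subspaceT cv).
rewrite in_itv /= => /andP[t1s st].
have vst : v s <= v t by apply: smin; rewrite in_itv /= t1t lexx.
apply: le_trans vst.
have [st''|t's] := leP s t'; first exact: early.
apply: (le_trans (early t' t1t' (lexx _))).
set m := v s in smin *; have m0 : 0 <= m by exact: v_ge0.
have vm r : t1 <= r -> r <= s -> m <= v r.
  by move=> h1 h2; apply: smin; rewrite in_itv /= h1 (le_trans h2).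
(* As [v s = m], Gronwall's inequality for [v - m] has right-hand side zero and gives
   [v t' <= m]. *)
suff : v t' - m <= (v s - m) * expR (I rate t' s) by rewrite subrr mul0r subr_le0.
apply: (@gronwall_rate (fun r => v r - m) t' s N (ltW t's)).
  move=> r /andP[h1 h2]; have := vm r (le_trans t1t' h1) h2; have := v_leN r; lra.
move=> s' t'' Z h1 h2 h3 zZ.
have Z0 : 0 <= Z by apply: le_trans (zZ s' _); rewrite ?lexx // subr_ge0 vm //; lra.
have r0 : 0 <= I rate s' t'' by apply: I_ge0 => //; apply: aeS rate_ge0.
suff : v s' <= v t'' + I rate s' t'' * Z by lra.
rewrite /v !vvE; apply: clip_shift; first exact: mulr_ge0.
have as' : a <= s' by lra.
have t''t0 : t'' <= t0 by lra.
have := ut_ge as' h2 t''t0.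
suff : - Z * I rate s' t'' <= I (fun r => l0 v r - l1 v r) s' t'' by lra.
rewrite -IZ //; apply: le_I_oo.
- exact/locintZ.
- by apply: locintB; [exact: li0|exact: li1].
(* [vmax] is at least [m] everywhere and equals [v] on [[sigma r, r]], a part of [[t1, s]]. Hence
   [l0 v] is at least [m * rate] at [r], and the net loss is at most [rate] times [v - m]. *)
pose vmax r := Num.max (v r) m.
have cvmax : continuous vmax.
  by move=> r; apply: continuous_max; [exact: cv|exact: cvg_cst].
have vmax_ge r : r <= t0 -> m * 1 <= vmax r by move=> _; rewrite mulr1 /vmax le_max lexx orbT.
have h5 := @poslin_ge_scale _ _ pl0 t0 m vmax (fun=> 1) cvmax (@cst_continuous R R 1) vmax_ge.
have h6 := aeS2 (fun r k1 k2 => conj k1 k2) rate_l0 (l0_sigma cv cvmax).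
apply: aeS3 h5 h6 (aeS2 (fun r k1 k2 => conj k1 k2) l1v_le rate_ge0).
move=> r k1 [k2 k3] [k4 k5] /andP[sr rt''].
have rt0 : r < t0 by lra.
have k6 : l0 v r = l0 vmax r.
  apply: k3; first exact: ltW.
  move=> x /andP[x1 x2]; rewrite /vmax (max_idPl _) //; apply: vm; last by lra.
  by apply: (le_trans (ltW (after r _ (ltW rt0)))) => //; lra.
have := k1 (ltW rt0); have := k2 (ltW rt0); have := k4 rt0.
have : m * rate r <= m * l0 (fun=> 1) r by apply: ler_wpM2l => //; exact: k2 (ltW rt0).
have : rate r * (v r - m) <= rate r * Z by apply: ler_wpM2l => //; apply: zZ; rewrite !ltW.
rewrite k6; lra.
Qed.

(** Because [N] exceeds [kappa], a value of [u] above [kappa] is visible in [v]; [v_floor] would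
    carry it to a value of [u t0] above the assumed bound. *)
Lemma half_line_le : u a <= N -> u t0 <= kappa * expR (- M) ->
  forall t, t <= t0 -> u t <= kappa.
Proof.
move=> uaN uc.
have main t : a <= t -> t <= t0 -> u t <= kappa.
  move=> at_ tt0; rewrite leNgt; apply/negP => ut.
  have vt : kappa < v t.
    rewrite /v vvE /clip lt_max; apply/orP; right; by rewrite lt_min ut andbT /N ltrDl.
  have h := v_floor at_ tt0 (lexx t0).
  have h2 : kappa * expR (- M) < v t * expR (- M) by rewrite ltr_pM2r ?expR_gt0.
  have v0 : 0 < v t0 by apply: lt_le_trans h; rewrite mulr_gt0 ?expR_gt0 // (lt_trans kappa0).
  by have := v_pos v0; lra.
move=> t tt0; have [ta|/ltW at_] := leP t a; last exact: main.
by rewrite (ua ta); exact: main.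
Qed.

Lemma half_line_top : u a = N -> kappa * expR (- M) < u t0.
Proof.
move=> uaN.
have va : v a = N by rewrite /v vvE uaN clip_id // N0 lexx.
have h := v_floor (lexx a) at0 (lexx t0); rewrite va in h.
have e0 := expR_gt0 (- M).
have h2 : kappa * expR (- M) < N * expR (- M) by rewrite ltr_pM2r // /N ltrDl.
have v0 : 0 < v t0 by apply: lt_le_trans h; rewrite mulr_gt0 // /N addr_gt0.
by have := v_pos v0; lra.
Qed.

End Estimates.

Lemma half_line_solution (a c : R) : a <= t0 -> 0 <= c <= kappa * expR (- M) ->
  exists2 u : R -> R, continuous u & [/\ forall t, t <= t0 -> 0 <= u t <= kappa, u t0 = c &
    sol (fun u t => l0 u t - l1 u t + f u t) u a t0].
Proof.
move=> at0 /andP[c0 cM].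
have [g lg Hg] := ft_bound.
have z0 : vv (fun=> 0) = (fun=> 0).
  by apply/funext => t; rewrite vvE clip_id // lexx N0.
have k0 : ck (fun=> 0) = (fun=> 0).
  by apply/funext => t; rewrite ckE clip_id // lexx ltW.
have F0 : {ae mu, forall t, t <= t0 -> ft (fun=> 0) t = 0}.
  apply: aeS3 (poslin0 pl0) (poslin0 pl1) f0 => t h1 h2 h3 tt0.
  by rewrite /ft z0 k0 h1 h2 h3 // subrr addr0.
have top (u : R -> R) : continuous u -> (forall t, t <= a -> u t = N) -> sol ft u a t0 -> c < u t0.
  move=> cu uN su; have ua : u a = N by exact: uN.
  apply: (le_lt_trans cM); apply: (half_line_top at0 cu _ su ua).
  by move=> t ta; rewrite uN // ua.
have [u cu [ua /andP[ua0 uaN] su uc]] := shooting vft lg Hg at0 N0 c0 F0 top.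
have ub t : t <= t0 -> 0 <= u t <= kappa.
  move=> tt0; rewrite (half_line_ge0 at0 cu ua ua0 su tt0) /=.
  by apply: (half_line_le at0 cu ua su) => //; rewrite uc.
(* With values in [[0, kappa]] both truncations are inactive up to [t0], and Volterra operators do
   not see later times. *)
exists u => //; split => // s t as_ st tt0; rewrite su //.
have [v0 _ _] := pl0; have [v1 _ _] := pl1.
have [_ _ V0] := v0; have [_ _ V1] := v1; have [_ _ Vf] := vf.
apply: eq_I_ae.
- by have [l _ _] := vft; exact: l.
- by apply: locintD; [apply: locintB; [exact: li0|exact: li1]|exact: lif].
have e1 r : r <= t0 -> vv u r = u r.
  by move=> /ub /andP[h1 h2]; have := kappa0; rewrite vvE clip_id // h1 /N; lra.
have e2 r : r <= t0 -> ck u r = u r by move=> /ub h; rewrite ckE clip_id.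
apply: aeS3 (V0 t0 _ _ (cvv cu) cu e1) (V1 t0 _ _ (cvv cu) cu e1) (Vf t0 _ _ (cck cu) cu e2).
move=> r h1 h2 h3 /andP[_ rt]; have rt0 := le_trans rt tt0.
by rewrite /ft h1 // h2 // h3.
Qed.

End HalfLine.

Lemma continuous_bounded_C0 (R : realType) (D : set R) (v : R -> R) (r : R) :
  continuous v -> (forall t, `|v t| <= r) -> (forall t, D (v t)) -> C0 D v.
Proof.
move=> cv vr vD; split => //.
by exists r; split => [|y ry s _]; [exact: num_real|exact: le_trans (vr s) (ltW ry)].
Qed.

(** * Extension beyond t0 and passage to the limit *)

Section Forward.
Context {R : realType}.
Notation mu := (@lebesgue_measure R).
Variables (l0 l1 f : (R -> R) -> R -> R).
Hypotheses (pl0 : poslin l0) (pl1 : poslin l1) (vf : volterra_op f).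
Variables (t0 kappa : R) (q : R -> R -> R).
Hypothesis kappa0 : 0 < kappa.
Hypotheses (f_car : forall r : R, 0 < r -> exists2 g, locint g &
     forall v : R -> R, continuous v -> (forall t, `|v t| <= r) -> {ae mu, forall t, `|f v t| <= g t})
  (f_le : forall v : R -> R, C0 setT v -> 0 <= v t0 <= kappa ->
     (forall t, t <= t0 -> - kappa <= v t <= kappa) ->
     {ae mu, forall t, t0 <= t -> f v t * Num.sg (v t) <= q t (sup_norm v)})
  (q_sublinear : forall T, t0 < T -> exists Q : R -> R -> R,
     (forall x, 0 <= x -> [/\ locint (Q x), {ae mu, forall t, 0 <= Q x t} &
        {ae mu, forall t, t0 <= t <= T -> q t x <= Q x t}]) /\
     forall e : R, 0 < e -> exists A : R, forall x, 0 <= x -> A <= x -> I (Q x) t0 T <= e * x).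

Let rhs u t := l0 u t - l1 u t + f u t.

Let li0 u : continuous u -> locint (l0 u). Proof. by have [[l _ _] _ _] := pl0; exact: l. Qed.
Let li1 u : continuous u -> locint (l1 u). Proof. by have [[l _ _] _ _] := pl1; exact: l. Qed.
Let lif u : continuous u -> locint (f u). Proof. by have [l _ _] := vf; exact: l. Qed.

Let vrhs : volterra_op rhs.
Proof.
have [v0 _ _] := pl0; have [v1 _ _] := pl1.
by apply: volterra_opD => //; exact: volterra_opB.
Qed.

Let lirhs u : continuous u -> locint (rhs u). Proof. by have [l _ _] := vrhs; exact: l. Qed.

Let gain t := l0 (fun=> 1) t + l1 (fun=> 1) t.

Let lgain : locint gain.
Proof. by apply: locintD; [apply: li0|apply: li1]; exact: cst_continuous. Qed.

Let gain_ge0 : {ae mu, forall t, 0 <= gain t}.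
Proof.
have [_ _ p0] := pl0; have [_ _ p1] := pl1; have c1 := @cst_continuous R R 1.
have h0 := p0 _ c1 (fun=> ler01); have h1 := p1 _ c1 (fun=> ler01).
by apply: aeS2 h0 h1 => t; exact: addr_ge0.
Qed.

Section Apriori.
Variables (T r : R) (u v Q : R -> R).
Hypotheses (t0T : t0 <= T) (kr : kappa <= r) (cv : continuous v)
  (vhist : forall t, t <= t0 -> 0 <= v t <= kappa)
  (vclip : forall t, t0 <= t <= T -> v t = clip (- r) r (u t))
  (usol : forall s t, t0 <= s -> s <= t -> t <= T -> u t - u s = I (rhs v) s t).
(** Stopping at [T] yields a bounded function on the line, to which [f_le] applies, with a supremum
    norm determined by the values up to [T]. *)
Let V t := v (Num.min t T).
Hypotheses (lQ : locint Q) (Q_ge0 : {ae mu, forall t, 0 <= Q t})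
  (fQ : {ae mu, forall t, t0 <= t <= T -> f V t * Num.sg (V t) <= Q t}).

Let cV : continuous V. Proof. exact: stop_continuous. Qed.

Lemma stopped_bound t : `|V t| <= r.
Proof.
have k0 := kappa0; have kr' := kr; rewrite /V; set s := Num.min t T.
have sT : s <= T by rewrite ge_min lexx orbT.
have [st0|/ltW t0s] := leP s t0.
  by have /andP[h1 h2] := vhist st0; rewrite ger0_norm //; lra.
by rewrite vclip ?t0s // ler_norml clip_itv //; lra.
Qed.

Let z t := sup [set `|V s| | s in [set s | s <= t]].

Let z_sup t : has_sup [set `|V s| | s in [set s | s <= t]].
Proof.
split; first by exists `|V t|, t => /=.
by exists r => _ [s _ <-]; exact: stopped_bound.
Qed.

Let z_ge s t : s <= t -> `|V s| <= z t.
Proof. by move=> st; apply: (ub_le_sup (z_sup t).2); exists s. Qed.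

Let z_le t B : (forall s, s <= t -> `|V s| <= B) -> z t <= B.
Proof. by move=> H; apply: ge_sup; [exact: (z_sup t).1|move=> _ [s /= st <-]; exact: H]. Qed.

Let z_ge0 t : 0 <= z t.
Proof. exact: le_trans (normr_ge0 _) (z_ge (lexx t)). Qed.

Let VE t : t <= T -> V t = v t. Proof. by move=> tT; rewrite /V (min_idPl tT). Qed.

(* Follow [e * V], [e] the sign of [V t], back to the last time [r0] where it is not positive. *)
Let growth s t : t0 <= s -> s <= t -> t <= T ->
  `|V t| <= `|V s| + (z t * I gain s t + I Q s t).
Proof.
move=> t0s st tT; set c := z t * _ + _.
have Ig p p' : 0 <= I gain p p' by apply: I_ge0 => //; apply: aeS gain_ge0.
have IQ p p' : 0 <= I Q p p' by apply: I_ge0 => //; apply: aeS Q_ge0.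
have c0 : 0 <= c by rewrite addr_ge0 // mulr_ge0.
have [->|Vt] := eqVneq (V t) 0; first by rewrite normr0 addr_ge0.
pose e := Num.sg (V t); pose W x := e * V x.
have We : W t = `|V t| by rewrite /W /e normrEsg.
have Wt : 0 < W t by rewrite We normr_gt0.
have cW : continuous W by move=> x; apply: cvgM; [exact: cvg_cst|exact: cV].
pose B := [set x | s <= x <= t /\ (W x <= 0 \/ x = s)].
have Bs : B s by split; [rewrite lexx|right].
have hB : has_sup B by split; [exists s|exists t => x [/andP[]]].
pose r0 := sup B.
have sr0 : s <= r0 by exact: (ub_le_sup hB.2).
have r0t : r0 <= t by apply: ge_sup => [|x [/andP[]]//]; exists s.
have Wpos x : r0 < x -> x <= t -> 0 < W x.
  move=> r0x xt; rewrite ltNge; apply/negP => Wx.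
  have : x <= r0 by apply: (ub_le_sup hB.2); split; [rewrite xt (le_trans sr0 (ltW r0x))|left].
  by rewrite leNgt r0x.
have Wabs x : W x <= `|V x|.
  rewrite /W /e; case: (sgrP (V t)) => _; rewrite ?mul0r ?normr_ge0 ?mul1r ?ler_norm //.
  by rewrite mulN1r -normrN ler_norm.
have Wr0 : W r0 <= `|V s|.
  have [->|sr0'] := eqVneq r0 s; first exact: Wabs.
  apply: (@le_trans _ _ 0) => //; rewrite leNgt; apply/negP => lt.
  have {}sr0' : s < r0 by rewrite lt_neqAle eq_sym sr0'.
  have Wc : W x @[x --> r0] --> W r0 by exact: cW.
  have [d /= d0 Hd] := cvgr_gt _ Wc _ lt.
  have d'0 : 0 < Num.min d (r0 - s) by rewrite lt_min d0 subr_gt0.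
  have [x [/andP[sx xt] xB] xd] := sup_adherent d'0 hB.
  have xr0 : x <= r0 by apply: (ub_le_sup hB.2); split => //; apply/andP.
  have h1 : Num.min d (r0 - s) <= d by rewrite ge_min lexx.
  have h2 : Num.min d (r0 - s) <= r0 - s by rewrite ge_min lexx orbT.
  rewrite -/r0 in xd.
  have Wx : 0 < W x by apply: Hd; rewrite /ball_ /= ger0_norm ?subr_ge0 //; lra.
  by case: xB => [|xs]; [rewrite leNgt Wx|lra].
have er : e * (u t - u r0) <= c.
  have t0r0 : t0 <= r0 by exact: le_trans sr0.
  rewrite usol // -IZ; last exact: lirhs.
  apply: (@le_trans _ _ (I (fun x => z t * gain x + Q x) r0 t)); last first.
    have lzQ := locintD (locintZ (z t) lgain) lQ.
    rewrite /c -IZ // -ID //; last exact: locintZ.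
    apply: le_I_itv => //; apply: aeS2 gain_ge0 Q_ge0 => x h1 h2.
    by rewrite addr_ge0 // mulr_ge0.
  apply: le_I_oo.
  - exact/locintZ/lirhs.
  - by apply: locintD => //; exact: locintZ.
  have Vz x : x <= t -> `|V x| <= z t by exact: z_ge.
  have [_ _ vv] := vrhs.
  have h1 : {ae mu, forall x, x <= T -> rhs v x = rhs V x}.
    by apply: vv => // x xT; rewrite VE.
  have h2 := aeS2 (fun x k1 k2 => conj k1 k2) (poslin_abs pl0 cV Vz) (poslin_abs pl1 cV Vz).
  apply: aeS3 h1 h2 fQ => x k1 [k2 k3] k4 /andP[r0x xt].
  have xT : x <= T by lra.
  have t0x : t0 <= x by lra.
  rewrite k1 // /rhs /gain.
  have {}k2 := k2 (ltW xt); have {}k3 := k3 (ltW xt).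
  have {}k4 := k4; rewrite t0x xT in k4; have {}k4 := k4 isT.
  have sgx : Num.sg (V x) = e.
    have := Wpos x r0x (ltW xt); rewrite /W /e; case: (sgrP (V t)) => _.
    - by rewrite mul0r ltxx.
    - by rewrite mul1r => /gtr0_sg.
    - by rewrite mulN1r oppr_gt0 => /ltr0_sg.
  rewrite sgx in k4.
  have e1 y : e * y <= `|y|.
    rewrite /e; case: (sgrP (V t)) => _; rewrite ?mul0r ?normr_ge0 ?mul1r ?ler_norm //.
    by rewrite mulN1r -normrN ler_norm.
  have := e1 (l0 V x); have := e1 (- l1 V x); rewrite normrN; lra.
have tI : t0 <= t <= T by rewrite tT (le_trans t0s).
have r0I : t0 <= r0 <= T by rewrite (le_trans t0s) // (le_trans r0t).
suff : W t <= W r0 + c by rewrite We; lra.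
rewrite /W !VE ?(andP tI).2 ?(andP r0I).2 // !vclip //.
move: er; rewrite /e; case: (sgrP (V t)) => _.
- by rewrite !mul0r add0r.
- rewrite !mul1r => er; apply: clip_shift => //; lra.
- rewrite !mulN1r => er.
  have : clip (- r) r (u r0) <= clip (- r) r (u t) + c by apply: clip_shift => //; lra.
  lra.
Qed.

Let z_step s t : t0 <= s -> s <= t -> t <= T -> z t <= z s + (z t * I gain s t + I Q s t).
Proof.
move=> t0s st tT.
have Ig p p' : 0 <= I gain p p' by apply: I_ge0 => //; apply: aeS gain_ge0.
have IQ p p' : 0 <= I Q p p' by apply: I_ge0 => //; apply: aeS Q_ge0.
apply: z_le => x xt; have [xs|/ltW sx] := leP x s.
  apply: (le_trans (z_ge xs)); rewrite lerDl addr_ge0 // mulr_ge0 //.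
apply: (le_trans (growth t0s sx (le_trans xt tT))).
apply: lerD; first exact: z_ge.
apply: lerD; last by rewrite (I_chasles lQ sx xt) lerDl.
apply: ler_pM => //; last by rewrite (I_chasles lgain sx xt) lerDl.
by apply: z_le => y yx; apply: z_ge; exact: le_trans yx xt.
Qed.

Lemma sup_norm_stopped : (forall t, `|V t| <= sup_norm V) /\
  sup_norm V <= (kappa + I Q t0 T) * expR (I gain t0 T).
Proof.
have IQ p p' : 0 <= I Q p p' by apply: I_ge0 => //; apply: aeS Q_ge0.
have hs : has_sup [set `|V t| | t in [set: R]].
  split; first by exists `|V 0|, 0.
  by exists r => _ [t _ <-]; exact: stopped_bound.
split; first by move=> t; apply: (ub_le_sup hs.2); exists t.
apply: (@le_trans _ _ (z T)).
  apply: ge_sup; first exact: hs.1.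
  move=> _ [t _ <-]; have -> : V t = V (Num.min t T).
    by rewrite /V -minA minxx.
  by apply: z_ge; rewrite ge_min lexx orbT.
(* The remaining integral of [Q] absorbs the inhomogeneous term of [z_step]. *)
pose y t := z t + I Q t T.
have yT : y T = z T by rewrite /y I_refl addr0.
have zt0 : z t0 <= kappa.
  apply: z_le => s st0; rewrite VE ?(le_trans st0) //.
  by have /andP[h1 h2] := vhist st0; rewrite ger0_norm.
apply: (@le_trans _ _ (y t0 * expR (I gain t0 T))); last first.
  by rewrite ler_wpM2r ?expR_ge0 // lerD2r.
rewrite -yT.
have PE s t : t0 <= s -> s <= t -> I gain t0 t - I gain t0 s = I gain s t.
  by move=> h1 h2; rewrite (I_chasles lgain h1 h2) addrAC subrr add0r.
(* [gronwall] bounds earlier values by later ones, so time is reversed. *)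
have := @gronwall R (fun x => - I gain t0 (- x)) (fun x => y (- x)) (- T) (- t0) (r + I Q t0 T).
rewrite !opprK I_refl oppr0 add0r; apply.
- by rewrite lerN2.
- move=> s t h1 h2 h3; rewrite lerN2 -subr_ge0 PE ?lerN2 //; last by rewrite lerNr.
  by apply: I_ge0 => //; apply: aeS gain_ge0.
- move=> e e0; have [d d0 Hd] := I_unif t0 T lgain e0; exists d => // s t h1 h2 h3 h4.
  have -> : - I gain t0 (- t) - - I gain t0 (- s) = I gain (- t) (- s).
    by rewrite -(PE (- t)) ?lerN2 //; [ring|rewrite lerNr].
  apply: le_lt_trans (Hd (- t) (- s) _ _ _ _); rewrite ?lerN2 //; try lra.
  by apply: le_trans (ler_norm _) _; exact: I_abs.
- move=> t /andP[h1 h2]; rewrite /y addr_ge0 //=; apply: lerD.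
    by apply: z_le => s _; exact: stopped_bound.
  by apply: le_I_itv => //; lra.
move=> s t Z h1 h2 h3 yZ.
have -> : - I gain t0 (- t) - - I gain t0 (- s) = I gain (- t) (- s).
  by rewrite -(PE (- t)) ?lerN2 //; [ring|rewrite lerNr].
have h4 : t0 <= - t by lra.
have h5 : - t <= - s by lra.
have h6 : - s <= T by lra.
have h7 := z_step h4 h5 h6.
have Ig : 0 <= I gain (- t) (- s) by apply: I_ge0 => //; apply: aeS gain_ge0.
have h8 := yZ s; rewrite lexx h2 in h8; have {}h8 := h8 isT.
have h9 : z (- s) <= Z by apply: le_trans h8; rewrite /y lerDl.
have h10 := ler_wpM2r Ig h9.
rewrite /y (I_chasles lQ h5 h6); lra.
Qed.

End Apriori.

(** The point is that [rho] does not depend on the truncation level [r]. Let [X] be the norm of the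
    stopped function: if [X] is at least [A], the choice of [(2 * E)^-1] bounds the contribution of
    [Q X] by [X / 2], so [X <= 2 * kappa * E]. *)
Let apriori T : t0 < T -> exists rho : R, forall r (u v : R -> R),
  kappa <= r -> continuous v ->
  (forall t, t <= t0 -> 0 <= v t <= kappa) ->
  (forall t, t0 <= t <= T -> v t = clip (- r) r (u t)) ->
  (forall s t, t0 <= s -> s <= t -> t <= T -> u t - u s = I (rhs v) s t) ->
  forall t, t <= T -> `|v t| <= rho.
Proof.
move=> t0T; have [Q [HQ subl]] := q_sublinear t0T.
pose E := expR (I gain t0 T); have E0 : 0 < E by exact: expR_gt0.
have e0 : 0 < (2 * E)^-1 by rewrite invr_gt0 mulr_gt0.
have [A HA] := subl _ e0.
exists (Num.max A (2 * kappa * E)) => r u v kr cv vh vc us t tT.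
pose V t := v (Num.min t T); pose X := sup_norm V.
have t0T' := ltW t0T.
have Vr := stopped_bound kr vh vc.
have X0 : 0 <= X.
  apply: le_trans (normr_ge0 (V 0)) _; apply: ub_le_sup; last by exists 0.
  by exists r => _ [s _ <-]; exact: Vr.
have [lQ Q0 qQ] := HQ X X0.
have Vh s : s <= t0 -> 0 <= V s <= kappa.
  by move=> st0; rewrite /V (min_idPl (le_trans st0 t0T')) vh.
have fQ : {ae mu, forall s, t0 <= s <= T -> f V s * Num.sg (V s) <= Q X s}.
  have CV : C0 setT V by apply: continuous_bounded_C0 Vr _ => //; exact: stop_continuous.
  have Vt0 : 0 <= V t0 <= kappa by exact: Vh.
  have Vh' s : s <= t0 -> - kappa <= V s <= kappa.
    by move=> /Vh /andP[h1 h2]; have := kappa0; rewrite h2 andbT; lra.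
  by apply: aeS2 (f_le CV Vt0 Vh') qQ => s h1 h2 sI; apply: le_trans (h1 _) (h2 sI); case/andP: sI.
have [XV] := sup_norm_stopped t0T' kr cv vh vc us lQ Q0 fQ.
rewrite -/V -/X -/E => Xle.
have -> : v t = V t by rewrite /V (min_idPl tT).
apply: (le_trans (XV t)); rewrite -/V -/X le_max.
have [AX|/ltW ->//] := leP A X; apply/orP; right.
have h := HA X X0 AX.
have h2 : I (Q X) t0 T * E <= X / 2.
  apply: (@le_trans _ _ ((2 * E)^-1 * X * E)); first by rewrite ler_wpM2r // ltW.
  by have -> : (2 * E)^-1 * X * E = X / 2 by field; rewrite gt_eqF.
lra.
Qed.

Lemma forward_extension T (phi : R -> R) : t0 < T -> continuous phi ->
  (forall t, t <= t0 -> 0 <= phi t <= kappa) ->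
  exists2 u : R -> R, continuous u & (forall t, t <= t0 -> u t = phi t) /\ sol rhs u t0 T.
Proof.
move=> t0T cphi phih; have [rho Hrho] := apriori t0T.
(* A level strictly above [rho] makes the truncation inactive on [[t0, T]], by [clip_inside]. The
   solution sought is [chi u]: the unknown [u] itself has constant history. *)
pose r := Num.max (rho + 1) kappa.
have r0 : 0 < r by rewrite lt_max kappa0 orbT.
have rhor : rho < r by rewrite lt_max; apply/orP; left; lra.
have kr : kappa <= r by rewrite le_max lexx orbT.
pose psi t := phi (Num.min t t0) - phi t0.
have cpsi : continuous psi.
  by move=> t; apply: cvgB; [exact: stop_continuous|exact: cvg_cst].
pose chi u := shift_clip (- r) r psi u.
have cchi : causal_map chi by exact: shift_clip_causal.
have chir u t : `|chi u t| <= r.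
  by rewrite ler_norml clip_itv //; lra.
have [_ _ [cc _]] := cchi.
have [g lg Hg] : exists2 g, locint g &
    forall u, continuous u -> {ae mu, forall t, `|rhs (chi u) t| <= g t}.
  have [q' lq' Hq'] := f_car r0.
  exists (fun t => r * gain t + q' t); first by apply: locintD => //; exact: locintZ.
  move=> u cu; have cu' := cc u cu.
  have h k : {ae mu, forall t, t <= k -> `|rhs (chi u) t| <= r * gain t + q' t}.
    have b t : t <= k -> `|chi u t| <= r by [].
    apply: aeS3 (poslin_abs pl0 cu' b) (poslin_abs pl1 cu' b) (Hq' _ cu' (chir u)).
    move=> t h1 h2 h3 tk; have := h1 tk; have := h2 tk; rewrite /rhs /gain.
    have := ler_normD (l0 (chi u) t - l1 (chi u) t) (f (chi u) t).
    by have := ler_normB (l0 (chi u) t) (l1 (chi u) t); lra.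
  have /ae_nat := fun n : nat => h n%:R.
  apply: aeS => t H; apply: (H (Num.trunc `|t|).+1).
  by apply: le_trans (ler_norm _) _; apply/ltW; exact: truncnS_gt.
have [u cu [uh us]] := cauchy_problem (volterra_op_comp cchi vrhs) lg Hg t0 T (phi t0).
pose v := chi u; have cv : continuous v by exact: cc.
have vphi t : t <= t0 -> v t = phi t.
  move=> tt0; rewrite /v /chi /shift_clip /psi (min_idPl tt0) uh // addrC subrK clip_id //.
  by have /andP[h1 h2] := phih t tt0; apply/andP; split; lra.
have vh t : t <= t0 -> 0 <= v t <= kappa by move=> tt0; rewrite vphi // phih.
have vc t : t0 <= t <= T -> v t = clip (- r) r (u t).
  by move=> /andP[t0t _]; rewrite /v /chi /shift_clip /psi (min_idPr t0t) subrr addr0.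
have vrho := Hrho r u v kr cv vh vc us.
have vu t : t0 <= t <= T -> v t = u t.
  move=> tI; rewrite vc //; apply: clip_inside; rewrite -vc //.
  by apply: le_lt_trans rhor; apply: vrho; case/andP: tI.
exists v => //; split => // s t t0s st tT.
rewrite !vu; [exact: us| |]; apply/andP; split; lra.
Qed.

Lemma forward_bound T : exists2 g, locint g & forall u : R -> R, continuous u ->
  (forall t, t <= t0 -> 0 <= u t <= kappa) -> sol rhs u t0 T ->
  {ae mu, forall t, t <= T -> `|rhs u t| <= g t}.
Proof.
suff [rho H] : exists rho, forall u : R -> R, continuous u ->
    (forall t, t <= t0 -> 0 <= u t <= kappa) -> sol rhs u t0 T -> forall t, t <= T -> `|u t| <= rho.
  pose r := Num.max rho kappa.
  have r0 : 0 < r by rewrite lt_max kappa0 orbT.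
  have [q' lq' Hq'] := f_car r0.
  exists (fun t => r * gain t + q' t); first by apply: locintD => //; exact: locintZ.
  move=> u cu uh us; have ur := H u cu uh us.
  pose w t := u (Num.min t T).
  have cw : continuous w by exact: stop_continuous.
  have wr t : `|w t| <= r.
    by rewrite le_max ur // ge_min lexx orbT.
  have b t : t <= T -> `|w t| <= r by [].
  have [_ _ vv] := vrhs.
  have h0 : {ae mu, forall t, t <= T -> rhs u t = rhs w t}.
    by apply: vv => // t tT; rewrite /w (min_idPl tT).
  have h1 := aeS2 (fun t k1 k2 => conj k1 k2) h0 (Hq' _ cw wr).
  apply: aeS3 (poslin_abs pl0 cw b) (poslin_abs pl1 cw b) h1.
  move=> t k1 k2 [k3 k4] tT; rewrite k3 //; have := k1 tT; have := k2 tT; rewrite /rhs /gain.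
  have := ler_normD (l0 w t - l1 w t) (f w t).
  by have := ler_normB (l0 w t) (l1 w t); lra.
have [Tt0|t0T] := leP T t0.
  exists kappa => u cu uh us t tT; have /andP[h1 h2] := uh t (le_trans tT Tt0).
  by rewrite ger0_norm.
have [rho Hrho] := apriori t0T.
exists rho => u cu uh us.
have [m _ um] := EVT_max (ltW t0T) (continuous_subspaceT (fun x => @cvg_norm _ _ _ _ _ _ _ (cu x))).
(* This level depends on [u] and makes the truncation trivial, whereas [rho] is common to all
   solutions. *)
pose r := Num.max `|u m| kappa.
apply: (Hrho r u u _ cu uh _ us); first by rewrite le_max lexx orbT.
move=> t tI; rewrite clip_id // -ler_norml le_max um //.
Qed.

Lemma global_limit c :
  (forall a, a <= t0 -> exists2 u : R -> R, continuous u &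
     [/\ forall t, t <= t0 -> 0 <= u t <= kappa, u t0 = c & sol rhs u a t0]) ->
  exists2 u : R -> R, continuous u &
    [/\ forall t, t <= t0 -> 0 <= u t <= kappa, u t0 = c & forall a b, sol rhs u a b].
Proof.
move=> half; have [_ _ vv] := vrhs.
(* On the right [n.+1] keeps the interval nondegenerate for [n = 0]. *)
have /choice[u uP] : forall n : nat, exists u : R -> R, [/\ continuous u,
    forall t, t <= t0 -> 0 <= u t <= kappa, u t0 = c & sol rhs u (t0 - n%:R) (t0 + n.+1%:R)].
  move=> n; have [|w cw [wh wc ws]] := half (t0 - n%:R); first by rewrite lerBlDr lerDl.
  have n1 : t0 < t0 + n.+1%:R by rewrite ltrDl.
  have [v cv [vw vs]] := forward_extension n1 cw wh.
  exists v; split => //; [by move=> *; rewrite vw // wh|by rewrite vw|].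
  have h : {ae mu, forall t, t <= t0 -> rhs w t = rhs v t} by apply: vv => // t /vw.
  have back s t : t0 - n%:R <= s -> s <= t -> t <= t0 -> v t - v s = I (rhs v) s t.
    move=> h1 h2 h3; rewrite !vw ?(le_trans h2) // ws //; apply: eq_I_ae; [exact: lirhs|exact: lirhs|].
    by apply: aeS h => r + /andP[_ rt]; apply; exact: le_trans h3.
  move=> s t h1 h2 h3; case: (leP t t0) => [|/ltW t0t]; first exact: back.
  case: (leP t0 s) => [t0s|/ltW st0]; first exact: vs.
  by rewrite (I_chasles (lirhs cv) st0 t0t) -back // -vs //; ring.
have [G [ultraG ooG]] := ultraFilterLemma (@eventually_filter : ProperFilter \oo).
have large (x : R) : G [set n | x <= n%:R].
  apply: ooG; exists (Num.trunc `|x|).+1 => // n /= xn.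
  apply: le_trans (ler_norm _) (le_trans (ltW (truncnS_gt _)) _).
  by rewrite ler_nat.
have cu n : continuous (u n) by have [] := uP n.
have [||v cv uv] := @ultra_limit _ G ultraG u t0 `|c|.
- move=> B; pose T := Num.max B t0; have [g lg Hg] := forward_bound T.
  exists g => //; apply: filterS (large (`|t0| + `|B|)) => n /= nB s t Bs st tB.
  have [_ uh _ us] := uP n.
  have n1 : n.+1%:R = n%:R + 1 :> R by rewrite -natr1.
  have := ler_norm t0; have := ler_norm (- t0); have := ler_norm B; have := ler_norm (- B).
  rewrite !normrN => k1 k2 k3 k4.
  have TB : T <= t0 + n.+1%:R by rewrite ge_max; apply/andP; split; lra.
  have usT : sol rhs (u n) t0 T.
    by move=> p r h1 h2 h3; apply: us => //; [lra|exact: le_trans TB].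
  rewrite us //; try lra.
  apply: le_trans (I_abs _ _ (lirhs (cu n))) _.
  apply: le_I => //; first exact/locint_abs/lirhs.
  apply: aeS (Hg _ (cu n) uh usT) => r + /andP[_ rt]; apply.
  by rewrite le_max (le_trans rt).
- by apply: filterS (large 0) => n _ /=; have [_ _ ->] := uP n.
exists v => //; split.
- move=> t tt0; apply/andP; split.
    apply: (ultra_ge (fun e e0 => lucvg_pt t uv e0)); apply: filterS (large 0) => n _ /=.
    by have [_ + _ _] := uP n => /(_ t tt0)/andP[].
  apply: (ultra_le (fun e e0 => lucvg_pt t uv e0)); apply: filterS (large 0) => n _ /=.
  by have [_ + _ _] := uP n => /(_ t tt0)/andP[].
- apply/eqP; rewrite eq_le; apply/andP; split.
    apply: (ultra_le (fun e e0 => lucvg_pt t0 uv e0)); apply: filterS (large 0) => n _ /=.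
    by have [_ _ ->] := uP n.
  apply: (ultra_ge (fun e e0 => lucvg_pt t0 uv e0)); apply: filterS (large 0) => n _ /=.
  by have [_ _ ->] := uP n.
move=> a b; apply: (limit_sol vrhs uv uv cv cu).
apply: filterS (large (`|t0| + `|a| + `|b|)) => n /= nab s t as_ st tb.
have [_ _ _ us] := uP n; have n1 : n.+1%:R = n%:R + 1 :> R by rewrite -natr1.
have := ler_norm t0; have := ler_norm (- t0); have := ler_norm b; have := ler_norm (- a).
have := normr_ge0 a; have := normr_ge0 b; rewrite !normrN => *.
by apply: us => //; lra.
Qed.

End Forward.

(** * Transfer to Borel representatives *)

Section Transfer.
Context {R : realType}.
Implicit Types (T F : (R -> R) -> R -> R) (u v : R -> R).
Notation mu := (@lebesgue_measure R).

Lemma V_representative T : V T -> exists2 F, volterra_op F &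
  forall u, continuous u -> {ae mu, forall t, T u t = F u t}.
Proof.
move=> VT; have [F [FT cF]] := operator_representative (VT 0).1.
exists F => [|u cu]; last exact: (FT u cu).2.
split => // [u cu|zeta u v cu cv uv]; first exact: (FT u cu).1.
apply: aeS3 ((VT zeta).2 zeta (lexx _) u v cu cv uv) (FT u cu).2 (FT v cv).2.
by move=> t h <- <-.
Qed.

Lemma poslin_representative T F : volterra_op F ->
  (forall u, continuous u -> {ae mu, forall t, T u t = F u t}) ->
  linear_operator T -> positive_operator T -> poslin F.
Proof.
move=> vF TF linT posT; split => // [a u v cu cv|u cu u0].
  have cw : continuous (fun s => a * u s + v s).
    by move=> t; apply: cvgD; [apply: cvgM; [exact: cvg_cst|exact: cu]|exact: cv].
  apply: aeS3 (linT a u v cu cv) (TF _ cw) (aeS2 (fun t => @conj _ _) (TF u cu) (TF v cv)).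
  by move=> t + <- [<- <-].
by apply: aeS2 (posT u cu u0) (TF u cu) => t + <-.
Qed.

Lemma extend_right_continuous t0 (gamma : R -> R) :
  ACloc `]-oo, t0] `]0, +oo[ gamma -> continuous (extend_right t0 gamma).
Proof.
move=> [_ acg] x; pose a := Num.min x t0 - 1.
have at0 : a <= t0 by have : Num.min x t0 <= t0 by [rewrite ge_min lexx orbT]; rewrite /a; lra.
have sub : `[a, t0] `<=` `]-oo, t0] by move=> y; rewrite /= !in_itv /= => /andP[].
have ax : a < x by have : Num.min x t0 <= x by [rewrite ge_min lexx]; rewrite /a; lra.
have E y : a <= y -> extend_right t0 gamma y = (gamma \o clip a t0) y.
  move=> ay; rewrite /extend_right /clip /= minC; congr gamma.
  by rewrite (max_idPr _) // le_min at0.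
have : (gamma \o clip a t0) y @[y --> x] --> (gamma \o clip a t0) x.
  exact: (ac_clip_continuous at0 (acg _ _ at0 sub)).
rewrite /continuous_at -E ?ltW //; apply: cvg_trans; apply: near_eq_cvg; near=> y; rewrite -E //.
by near: y; exact: (cvgr_ge _ cvg_id _ ax).
Unshelve. all: by end_near. Qed.

(** By monotonicity the supremum of [q t] over [[0, x]] is [q t x]; the integrability demanded by
    [Kloc] thus yields a Borel version of [q] at level [x], put to zero outside [[t0, b]]. *)
Lemma sublinear_majorant t0 (q : R -> R -> R) : Kloc t0 q ->
  (forall t x y : R, t0 <= t -> 0 <= x -> x <= y -> q t x <= q t y) ->
  (forall c : R, t0 < c -> x^-1 * (\int[mu]_(s in `[t0, c]) q s x) @[x --> +oo] --> 0) ->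
  forall b, t0 < b -> exists Q : R -> R -> R,
    (forall x, 0 <= x -> [/\ locint (Q x), {ae mu, forall t, 0 <= Q x t} &
       {ae mu, forall t, t0 <= t <= b -> q t x <= Q x t}]) /\
    forall e : R, 0 < e -> exists A : R, forall x, 0 <= x -> A <= x -> I (Q x) t0 b <= e * x.
Proof.
move=> [q0 _ _ qK] q_nd q_lim b t0T; have t0T' := ltW t0T.
have /choice[Q QP] : forall x : R, exists h, 0 <= x -> locint h /\
    {ae mu, forall t, h t = if t0 <= t <= b then q t x else 0}.
  move=> x; have [x0|] := leP 0 x; last by exists 0.
  have sub : `[0, x] `<=` `[0, +oo[ by move=> y; rewrite /= !in_itv /= andbT => /andP[].
  have subT : `[t0, b] `<=` `[t0, +oo[ by move=> y; rewrite /= !in_itv /= andbT => /andP[].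
  have [h ih qh] := qK _ (@segment_compact _ 0 x) sub t0 b t0T' subT.
  exists (h \_ `[t0, b]) => _; split.
    have ihr : mu.-integrable setT (EFin \o (h \_ `[t0, b])).
      by rewrite -restrict_EFin; apply/integrable_restrict => //; rewrite setTI.
    split; first by apply/measurable_EFinP; exact: measurable_int ihr.
    by move=> c d; apply: integrableS ihr.
  apply: aeS qh => t /= H; rewrite patchE mem_setE in_itv /=; case: ifP => // tI.
  rewrite -H ?in_itv //; apply/eqP; rewrite eq_le; apply/andP; split.
    apply: ge_sup; first by exists (q t 0), 0 => //=; rewrite in_itv /= lexx.
    move=> _ [y /= + <-]; rewrite in_itv /= => /andP[y0 yx].
    by apply: q_nd => //; case/andP: tI.
  apply: ub_le_sup; last by exists x => //=; rewrite in_itv /= x0 lexx.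
  exists (q t x) => _ [y /= + <-]; rewrite in_itv /= => /andP[y0 yx].
  by apply: q_nd => //; case/andP: tI.
exists Q; split.
  move=> x x0; have [lQ Qq] := QP x x0; split => //.
    apply: aeS Qq => t ->; case: ifP => // /andP[t0t _]; exact: q0.
  by apply: aeS Qq => t -> ->.
move=> e e0; have /cvgrPdist_lt/(_ e e0)[A [_ HA]] := q_lim b t0T.
(* Makes [x] exceed the threshold [A] strictly and be positive, as the division by [x] requires. *)
exists (Num.max A 0 + 1) => x x0 Ax.
have xA : A < x by apply: lt_le_trans Ax; rewrite ltr_pwDr // le_max lexx.
have {}x0 : 0 < x by apply: lt_le_trans Ax; rewrite ltr_pwDr // le_max lexx orbT.
have := HA x xA; rewrite /= sub0r normrN => H.
have [_ Qq] := QP x (ltW x0).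
have -> : I (Q x) t0 b = \int[mu]_(s in `[t0, b]) q s x.
  rewrite /I /Rintegral; congr fine; apply: ae_integral.
  by apply: aeS Qq => t -> /=; rewrite in_itv /= => ->.
rewrite mulrC -ler_pdivrMl //; exact: le_trans (ler_norm _) (ltW H).
Qed.

(** The supremum dominates a finite integral, so it is a real number and [fine] does not replace an
    infinite value by 0. *)
Lemma I_le_M_sigma (l1 : (R -> R) -> R -> R) (gamma sigma : R -> R) t0 (r : R -> R) :
  locint r ->
  {ae mu, forall s, s <= t0 -> l1 (extend_right t0 gamma) s / gamma s = r s} ->
  (M_sigma l1 gamma sigma t0 < +oo)%E ->
  forall t, t <= t0 -> I r (sigma t) t <= fine (M_sigma l1 gamma sigma t0).
Proof.
move=> lr Hr Mfin t tt0; set M := M_sigma _ _ _ _ in Mfin *.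
have rM : ((I r (sigma t) t)%:E <= M)%E.
  apply: ereal_sup_ubound; exists t; first by rewrite /= in_itv.
  rewrite /I /Rintegral fineK; last exact: integrable_fin_num (lr.2 _ _).
  apply: ae_integral; apply: aeS Hr => s H /=; rewrite in_itv /= => /andP[_ st].
  by rewrite H // (le_trans st).
have Mfn : M \is a fin_num.
  by rewrite fin_numE (lt_eqF Mfin) andbT gt_eqF // (lt_le_trans _ rM) // ltNyr.
by rewrite -lee_fin (fineK Mfn).
Qed.

End Transfer.

Theorem theorem2p1 (R : realType) (l0 l1 f : (R -> R) -> (R -> R))
    (l0_cont : continuous_operator l0) (l0_lin : linear_operator l0)
    (l0_pos : positive_operator l0)
    (l1_cont : continuous_operator l1) (l1_lin : linear_operator l1)
    (l1_pos : positive_operator l1)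
    (f_cont : continuous_operator f) (f_car : local_caratheodory f)
    (t0 : R) (l0_V : V l0) (l1_V : V l1) (f_V : V f)
    (sigma : R -> R) (sigma_Sigma : Sigma sigma)
    (l0_sigma : V_sigma t0 sigma l0)
    (f0 : {ae lebesgue_measure, forall t : R, t <= t0 -> f (fun=> 0) t = 0})
    (kappa : R) (kappa_gt0 : 0 < kappa)
    (f_ge0 : forall v : R -> R, C0 `[0, kappa] v ->
       {ae lebesgue_measure, forall t : R, t <= t0 -> 0 <= f v t})
    (q : R -> R -> R) (q_Kloc : Kloc t0 q)
    (q_nd : forall t x y : R, t0 <= t -> 0 <= x -> x <= y -> q t x <= q t y)
    (q_lim : forall b : R, t0 < b ->
       x^-1 * (\int[lebesgue_measure]_(s in `[t0, b]) q s x) @[x --> +oo] --> 0)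
    (f_le : forall v : R -> R, C0 setT v -> 0 <= v t0 <= kappa ->
       (forall t : R, t <= t0 -> - kappa <= v t <= kappa) ->
       {ae lebesgue_measure, forall t : R, t0 <= t ->
          f v t * Num.sg (v t) <= q t (sup_norm v)})
    (gamma : R -> R) (gamma_AC : ACloc `]-oo, t0] `]0, +oo[ gamma)
    (gamma_ineq : {ae lebesgue_measure, forall t : R, t <= t0 ->
       derive1 gamma t <= - l1 (extend_right t0 gamma) t /\
       l1 (extend_right t0 gamma) t / gamma t <= l0 (fun=> 1) t})
    (M_fin : (M_sigma l1 gamma sigma t0 < +oo)%E) :
  forall c : R,
    0 <= c <= kappa * expR (- fine (M_sigma l1 gamma sigma t0)) ->
    exists u : R -> R,
      [/\ global_solution l0 l1 f u, u t0 = c &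
          forall t : R, t <= t0 -> 0 <= u t <= kappa].
Proof.
move=> c cI; pose gam := extend_right t0 gamma.
have [csigma sigma_le] := sigma_Sigma.
have [L0 v0 r0] := V_representative l0_V; have pl0 := poslin_representative v0 r0 l0_lin l0_pos.
have [L1 v1 r1] := V_representative l1_V; have pl1 := poslin_representative v1 r1 l1_lin l1_pos.
have [F vF rF] := V_representative f_V.
have cgam : continuous gam by exact: extend_right_continuous gamma_AC.
have gamE t : t <= t0 -> gam t = gamma t by move=> tt0; rewrite /gam /extend_right (min_idPl tt0).
have gam0 t : 0 < gam t.
  have : `]-oo, t0]%classic (Num.min t t0) by rewrite /= in_itv /= ge_min lexx orbT.
  by move=> /gamma_AC.1; rewrite /= in_itv /= andbT.
have [lL1 _ _] := v1; have lg := lL1 _ cgam.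
have gam_le s t : s <= t -> t <= t0 -> I (L1 gam) s t <= gam s - gam t.
  move=> st tt0; have sub : `[s, t] `<=` `]-oo, t0].
    by move=> y; rewrite /= !in_itv /= => /andP[_ yt]; exact: le_trans tt0.
  have := ac_derive1_le (locintZ (-1) lg) st (gamma_AC.2 _ _ st sub).
  rewrite IZ // mulN1r !gamE ?(le_trans st) //.
  suff h : {ae lebesgue_measure, forall x, s < x < t -> derive1 gamma x <= -1 * L1 gam x}.
    by move=> /(_ h); lra.
  apply: aeS2 gamma_ineq (r1 _ cgam) => x H <- /andP[_ xt]; rewrite mulN1r.
  by have [] := H (le_trans (ltW xt) tt0).
have rate_l0 : {ae lebesgue_measure, forall t, t <= t0 -> rate L1 gam t <= L0 (fun=> 1) t}.
  have c1 := @cst_continuous R R 1.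
  apply: aeS3 gamma_ineq (r1 _ cgam) (r0 _ c1) => t H; rewrite /rate => <- <- tt0.
  by have [_] := H tt0; rewrite gamE.
have rate_M := I_le_M_sigma (locint_rate pl1 cgam gam0).
have f_car' r : 0 < r -> exists2 g, locint g & forall v : R -> R, continuous v ->
    (forall t, `|v t| <= r) -> {ae lebesgue_measure, forall t, `|F v t| <= g t}.
  move=> /f_car[qr [/Lloc_locint[g lg' qg] _ Hq]]; exists g => // v cv vr.
  by apply: aeS3 (Hq v cv vr) (rF v cv) qg => t + <- <-.
have half a : a <= t0 -> exists2 u : R -> R, continuous u &
    [/\ forall t, t <= t0 -> 0 <= u t <= kappa, u t0 = c &
        sol (fun u t => L0 u t - L1 u t + F u t) u a t0].
  move=> at0; apply: (half_line_solution pl0 pl1 vF kappa_gt0 cgam gam0 gam_le rate_l0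
    csigma sigma_le _ _ _ _ _ at0 cI).
  - move=> u v cu cv; apply: aeS3 (l0_sigma.2 u v cu cv) (r0 u cu) (r0 v cv) => t H <- <-.
    exact: H.
  - apply: rate_M => //; apply: aeS (r1 _ cgam) => s H st0; rewrite /rate -H gamE //.
  - move=> v cv vk; apply: aeS2 (rF v cv) (f_ge0 v _) => [t <- //|].
    apply: (@continuous_bounded_C0 _ _ _ kappa) => // t.
    by have /andP[h1 h2] := vk t; rewrite ger0_norm.
  - by apply: aeS2 f0 (rF _ (@cst_continuous R R 0)) => t + <-.
  - exact: f_car'.
have f_le' v : C0 setT v -> 0 <= v t0 <= kappa ->
    (forall t, t <= t0 -> - kappa <= v t <= kappa) ->
    {ae lebesgue_measure, forall t, t0 <= t -> F v t * Num.sg (v t) <= q t (sup_norm v)}.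
  move=> Cv h1 h2; have [cv _ _] := Cv.
  by apply: aeS2 (f_le v Cv h1 h2) (rF v cv) => t + <-.
have [u cu [uh uc us]] :=
  global_limit pl0 pl1 vF kappa_gt0 f_car' f_le' (sublinear_majorant q_Kloc q_nd q_lim) half.
pose rhs t := L0 u t - L1 u t + F u t.
have lrhs : locint rhs.
  have [l2 _ _] := v0; have [l3 _ _] := vF.
  by apply: locintD; [apply: locintB; [exact: l2|exact: lL1]|exact: l3].
exists u; split => //; split.
  split=> // a b ab _; apply: (I_ac (locint_abs lrhs)) => s t as_ st tb.
  by rewrite (us a b) //; exact: I_abs.
have sl s t : s <= t -> u t - u s = I rhs s t by move=> st; exact: (us s t).
have rE := aeS3 (fun t h1 h2 h3 => conj h1 (conj h2 h3)) (r0 u cu) (r1 u cu) (rF u cu).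
by apply: aeS2 (ae_is_derive_I lrhs sl) rE => t + [-> [-> ->]].
Qed.
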